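(* Let $X$ be a Banach space as described in the context and let $f\in X$. Then $f$ is (the restriction to $\mathbb{D}$ of) an entire function if and only if $$\lim_{n\to\infty}\big(E_n(f)\big)^{1/n}=0 .$$
   Context: $\mathbb{D}=\{z\in\mathbb{C}:|z|<1\}$. $X$ is a complex Banach space of functions analytic in $\mathbb{D}$ whose norm $\|\cdot\|$ satisfies: (i) $\|f(\cdot\, e^{it})\|=\|f(\cdot)\|$ for all $t\in\mathbb{R}$ and $f\in X$; (ii) $\|f\|<\infty$ for every entire function $f$ (i.e. $X$ contains all entire functions); (iii) for all $f\in X$ and $g\in L[0,2\pi]$, $\big\|\frac{1}{2\pi}\int_0^{2\pi} f(ze^{it})g(t)\,dt\big\|\le \frac{1}{2\pi}\int_0^{2\pi}|g(t)|\,dt\cdot\|f\|$ (the norm on the left is of the function of $z$). For $n\ge 1$, $\mathcal{P}_n$ is the set of complex algebraic polynomials of degree at most $n-1$, and $E_n(f)=\inf_{p\in\mathcal{P}_n}\|f-p\|$. *)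

(* Defs.v *)
From mathcomp Require Import all_boot all_order all_algebra.
From mathcomp Require Import all_classical all_reals all_analysis.
From mathcomp Require Import complex.
Import Order.TTheory GRing.Theory Num.Theory.
Import numFieldNormedType.Exports.

Set Implicit Arguments.
Unset Strict Implicit.
Unset Printing Implicit Defensive.

Local Open Scope classical_set_scope.
Local Open Scope ring_scope.
Local Open Scope complex_scope.

Section Defs.
Variable R : realType.

Definition udisc : set R[i] := [set z | `|z| < 1].

Definition cabs (z : R[i]) : R := complex.Re `|z|.

Definition holomorphic_on (A : set R[i]) (f : R[i] -> R[i]) : Prop :=
  forall z, A z -> derivable (f : R[i]^o -> R[i]^o) z 1.

Definition entire (f : R[i] -> R[i]) : Prop := holomorphic_on setT f.

Definition expit (t : R) : R[i] := cos t +i* sin t.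

Definition I02pi : set R := `[0, 2 * pi]%classic.

Definition cL1 (g : R -> R[i]) : Prop :=
  (lebesgue_measure).-integrable I02pi (EFin \o (fun t => complex.Re (g t))) /\
  (lebesgue_measure).-integrable I02pi (EFin \o (fun t => complex.Im (g t))).

Definition cint (h : R -> R[i]) : R[i] :=
  Complex (Rintegral lebesgue_measure I02pi (fun t => complex.Re (h t)))
          (Rintegral lebesgue_measure I02pi (fun t => complex.Im (h t))).

(* The Banach space X is modelled as a complete normed space V over C
   together with the map j : V -> (functions on D) realising its elements
   as functions analytic in D; j is linear and injective (as maps into
   functions on D).  Norm: cabs `|v|. *)
Definition admissible_space (V : completeNormedModType R[i]) (j : V -> R[i] -> R[i]) : Prop :=
  (forall (a : R[i]) (u v : V) z, udisc z -> j (a *: u + v) z = a * j u z + j v z) /\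
  (forall u v : V, (forall z, udisc z -> j u z = j v z) -> u = v) /\
  (forall u : V, holomorphic_on udisc (j u)) /\
  (forall (u : V) (t : R), exists w : V,
      (forall z, udisc z -> j w z = j u (z * expit t)) /\ cabs `|w| = cabs `|u|) /\
  (forall F, entire F -> exists w : V, forall z, udisc z -> j w z = F z) /\
  (forall (u : V) (g : R -> R[i]), cL1 g -> exists w : V,
      (forall z, udisc z ->
         j w z = ((2 * pi)^-1)%:C * cint (fun t => j u (z * expit t) * g t)) /\
      cabs `|w| <= (2 * pi)^-1 * Rintegral lebesgue_measure I02pi (fun t => cabs (g t))
                    * cabs `|u|).

Definition polys_n (V : completeNormedModType R[i]) (j : V -> R[i] -> R[i]) (n : nat) : set V :=
  [set p | exists q : {poly R[i]}, (size q <= n)%N /\ forall z, udisc z -> j p z = q.[z]].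

Definition E_n (V : completeNormedModType R[i]) (j : V -> R[i] -> R[i]) (n : nat) (f : V) : R :=
  inf [set cabs `|f - p| | p in polys_n j n].

End Defs.

(* Main.v *)
Require Import Defs.
From mathcomp Require Import all_boot all_order all_algebra.
From mathcomp Require Import all_classical all_reals all_analysis.
From mathcomp Require Import complex ring lra.
Import Order.TTheory GRing.Theory Num.Theory.
Import numFieldNormedType.Exports.
Local Open Scope classical_set_scope.
Local Open Scope ring_scope.

(* Convolution with e^{-ikt} shows |a_k(u)| ||z^k|| <= ||u|| for the Taylor
   coefficients a_k of u in X; hence coefficients are continuous, and a series
   sum b_k z^k whose terms decay geometrically in norm converges in X to a
   function with Taylor coefficients b_k.
   If f is the restriction of an entire F, then F(rho z) lies in X for every
   rho > 1, so |a_k(f)| ||z^k|| = O(rho^-k) and the Taylor polynomials of f give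
   E_n(f) = O(rho^-n).  Conversely |a_n(f)| ||z^n|| <= E_n(f), so if E_n(f) is
   smaller than every geometric sequence then sum a_k(f) N^k z^k converges in X
   to some w_N for every N, and z |-> w_N(z / N) extends f to |z| < N.
   The Taylor expansion of a function that is merely differentiable in the disc
   comes from a Goursat argument for the form h(w) dw / (w - z0) along the
   contraction z0 + s (r e^{it} - z0), 0 < s <= 1, of a circle onto z0. *)

(** [holomorphic_on] supplies a complex derivative at each point but no continuity of it, so
    Cauchy's formula cannot come from Green's theorem or from differentiation under the integral
    sign; this forces a subdivision argument. It runs in the parameter rectangle of [(s, t)], where
    the pieces are true rectangles and where the form splits into [ds / s] and a [dt] term free of
    [s]: the singularity at [z0] sits on the side [s = 0], which is approached but never reached.
    The norms of the monomials are never estimated. In both directions a dilation of the variable is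
    moved into the coefficients, and the product of a coefficient with the norm of its monomial is
    the only quantity compared with [E_n]. Most limits are carried as explicit geometric bounds, so
    that termwise integration and uniqueness of sums both reduce to [geometric_le0]. *)

Set Implicit Arguments.
Unset Strict Implicit.

(** * The real-valued modulus and the points of the unit circle *)

Section ComplexModulus.
Local Open Scope complex_scope.
Context {R : realType}.
Implicit Types (z w : R[i]) (x : R).

Lemma normCE z : `|z| = (cabs z)%:C.
Proof. by rewrite /cabs normc_def. Qed.

Lemma cabs_ge0 z : 0 <= cabs z.
Proof. by rewrite -ler0c -normCE. Qed.

Lemma cabs_realC x : cabs x%:C = `|x|.
Proof. by rewrite /cabs normc_def /= expr0n /= addr0 sqrtr_sqr. Qed.

Lemma cabs_nneg z : 0 <= z -> z = (cabs z)%:C.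
Proof. by move=> z0; rewrite -normCE ger0_norm. Qed.

Lemma cabs0 : cabs (0 : R[i]) = 0.
Proof. by rewrite /cabs normr0. Qed.

Lemma cabs_nat n : cabs (n%:R : R[i]) = n%:R.
Proof. by rewrite -(rmorph_nat (real_complex R)) cabs_realC ger0_norm. Qed.

Lemma cabs1 : cabs (1 : R[i]) = 1.
Proof. by rewrite /cabs normr1. Qed.

Lemma cabsi : cabs ('i : R[i]) = 1.
Proof. by rewrite /cabs normc_def /= expr0n add0r expr1n sqrtr1. Qed.

Lemma cabs_eq0 z : (cabs z == 0) = (z == 0).
Proof. by rewrite -[RHS]normr_eq0 normCE -(inj_eq (@complexI R)). Qed.

Lemma cabsM z w : cabs (z * w) = cabs z * cabs w.
Proof. by apply: complexI; rewrite -normCE normrM !normCE rmorphM. Qed.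

Lemma cabsX z n : cabs (z ^+ n) = cabs z ^+ n.
Proof. by apply: complexI; rewrite -normCE normrX !normCE rmorphXn. Qed.

Lemma cabsV z : cabs z^-1 = (cabs z)^-1.
Proof. by apply: complexI; rewrite -normCE normfV !normCE fmorphV. Qed.

Lemma cabsN z : cabs (- z) = cabs z.
Proof. by rewrite /cabs normrN. Qed.

Lemma cabsB z w : cabs (z - w) = cabs (w - z).
Proof. by rewrite -cabsN opprB. Qed.

Lemma cabsD z w : cabs (z + w) <= cabs z + cabs w.
Proof. by rewrite -lecR rmorphD /= -!normCE ler_normD. Qed.

Lemma cabs_triB z w : cabs z - cabs w <= cabs (z - w).
Proof. by rewrite lerBlDr -{1}(subrK w z) cabsD. Qed.

Lemma cabs_Re z : `|complex.Re z| <= cabs z.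
Proof.
rewrite /cabs normc_def /= -sqrtr_sqr ler_wsqrtr // lerDl sqr_ge0 //.
Qed.

Lemma cabs_Im z : `|complex.Im z| <= cabs z.
Proof.
rewrite /cabs normc_def /= -sqrtr_sqr ler_wsqrtr // lerDr sqr_ge0 //.
Qed.

Lemma cabs_le_ReIm z : cabs z <= `|complex.Re z| + `|complex.Im z|.
Proof.
rewrite {1}[z]complexE (le_trans (cabsD _ _)) // cabsM cabsi mul1r.
by rewrite !cabs_realC.
Qed.

Lemma udiscP z : udisc z <-> cabs z < 1.
Proof.
by rewrite /udisc /= normCE -[1 in X in X <-> _]/((1 : R)%:C) ltcR.
Qed.

Lemma expitD x y : expit (x + y) = expit x * expit y.
Proof. by rewrite /expit cosD sinD; apply/eqP; rewrite eq_complex /= eqxx /= addrC. Qed.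

Lemma expit0 : expit (0 : R) = 1.
Proof. by rewrite /expit cos0 sin0. Qed.

Lemma cabs_expit x : cabs (expit x) = 1.
Proof. by rewrite /cabs normc_def /= cos2Dsin2 sqrtr1. Qed.

Lemma expit_neq0 x : expit x != 0.
Proof. by rewrite -cabs_eq0 cabs_expit oner_neq0. Qed.

Lemma expitN x : expit (- x) = (expit x)^-1.
Proof.
apply: (mulfI (expit_neq0 x)).
by rewrite -expitD subrr expit0 mulfV ?expit_neq0.
Qed.

Lemma expitMn x n : expit x ^+ n = expit (n%:R * x).
Proof.
elim: n => [|n IH]; first by rewrite mul0r expit0 expr0.
by rewrite exprS IH -expitD mulrSr mulrDl mul1r addrC.
Qed.

Lemma expit2pi : expit (2 * pi : R) = 1.
Proof. by rewrite /expit mulr_natl cos2pi sin2pi. Qed.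

End ComplexModulus.

(** * Continuity of complex-valued functions of a real variable *)

Section Continuity.
Local Open Scope complex_scope.
Context {R : realType}.
(* [R[i]] has no topology of its own: it is only found on a [numFieldType]. *)
Local Notation C := (Num.NumField.sort (R[i] : numFieldType)).
Implicit Types (f g : R -> C) (x : R).

Lemma cont_realC x : {for x, continuous (fun y : R => y%:C : C)}.
Proof.
apply/cvgrPdist_lt => e e0.
(* In the order of [R[i]] a positive element is real, so [e] may be traded for its real part. *)
have e0' : 0 < complex.Re e by move: e0; rewrite ltcE /= => /andP[].
have eE : e = (complex.Re e)%:C by rewrite RRe_real // ger0_real ?ltW.
near=> y; rewrite -rmorphB normCE cabs_realC eE ltcR.
by near: y; apply: (@cvgr_dist_lt _ _ _ _ _ id x) => //; exact: cvg_id.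
Unshelve. all: by end_near. Qed.

Lemma cont_complex (u v : R -> R) x : {for x, continuous u} ->
  {for x, continuous v} -> {for x, continuous (fun y => u y +i* v y : C)}.
Proof.
move=> cu cv; have -> : (fun y => u y +i* v y : C) =
    (fun y => (u y)%:C + 'i * (v y)%:C).
  by apply/funext => y; rewrite [LHS]complexE.
have cr (w : R -> R) : {for x, continuous w} ->
    {for x, continuous (fun y => (w y)%:C : C)}.
  by move=> cw; exact: (continuous_comp cw (cont_realC (x := _))).
by apply: cvgD; [exact: cr|apply: cvgM; [exact: cvg_cst|exact: cr]].
Qed.

Lemma cont_ReIm f x : {for x, continuous f} ->
  {for x, continuous (fun y => complex.Re (f y) : R)} /\
  {for x, continuous (fun y => complex.Im (f y) : R)} /\
  {for x, continuous (fun y => cabs (f y) : R)}.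
Proof.
move=> /cvgrPdist_lt cf.
have H (e : R) : 0 < e -> \forall t \near x, cabs (f x - f t) < e.
  by move=> e0; have := cf e%:C; rewrite ltcR => /(_ e0); under eq_near do
    rewrite normCE ltcR.
split; last split; apply/cvgrPdist_lt => e /H He; near=> t.
- rewrite -raddfB /=; apply: le_lt_trans (cabs_Re _) _; by near: t.
- rewrite -raddfB /=; apply: le_lt_trans (cabs_Im _) _; by near: t.
- have ht : cabs (f x - f t) < e by near: t.
  apply: le_lt_trans ht; rewrite ler_norml lerNl opprB cabs_triB andbT.
  by rewrite cabsB cabs_triB.
Unshelve. all: by end_near. Qed.

Lemma cont_expit x : {for x, continuous (@expit R : R -> C)}.
Proof. by apply: cont_complex; [exact: continuous_cos|exact: continuous_sin]. Qed.

End Continuity.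

(** * Integrals of continuous complex-valued functions over a segment *)

Section ComplexIntegral.
Local Open Scope complex_scope.
Context {R : realType}.
Local Notation C := (Num.NumField.sort (R[i] : numFieldType)).
Local Notation mu := (@lebesgue_measure R).
Implicit Types (f g : R -> C) (a b c x : R).

(** On [[0, 2 * pi]] this is convertible to [cint], which lets the convolution of [admissible_space]
    be read as a [ci]. *)
Definition ci a b f : C :=
  Complex (Rintegral mu `[a, b] (fun t => complex.Re (f t)))
          (Rintegral mu `[a, b] (fun t => complex.Im (f t))).

(** Continuity is two-sided even at the endpoints: the integrands are given by formulas on the whole
    line, and closure under the operations becomes pointwise. *)
Definition cont_on a b f := forall x, a <= x <= b -> {for x, continuous f}.

Lemma cont_on_integrable a b f : cont_on a b f ->
  mu.-integrable `[a, b] (EFin \o (fun t => complex.Re (f t))) /\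
  mu.-integrable `[a, b] (EFin \o (fun t => complex.Im (f t))).
Proof.
move=> cf; split; apply: continuous_compact_integrable; try exact: segment_compact;
  apply: continuous_in_subspaceT => x /[!inE] /= /[!in_itv] /= xab.
- exact: (cont_ReIm (cf x xab)).1.
- exact: (cont_ReIm (cf x xab)).2.1.
Qed.

Lemma cont_on_sub a b c d f : a <= c -> d <= b -> cont_on a b f -> cont_on c d f.
Proof.
move=> ac db cf x /andP[cx xd]; apply: cf.
by rewrite (le_trans ac cx) (le_trans xd db).
Qed.

Lemma ReD (z w : C) : complex.Re (z + w) = complex.Re z + complex.Re w.
Proof. by case: z w => ? ? [? ?]. Qed.

Lemma ImD (z w : C) : complex.Im (z + w) = complex.Im z + complex.Im w.
Proof. by case: z w => ? ? [? ?]. Qed.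

Lemma cont_onD a b f g : cont_on a b f -> cont_on a b g ->
  cont_on a b (fun t => f t + g t).
Proof. by move=> cf cg x xab; apply: cvgD; [exact: cf|exact: cg]. Qed.

Lemma cont_onM a b f g : cont_on a b f -> cont_on a b g ->
  cont_on a b (fun t => f t * g t).
Proof. by move=> cf cg x xab; apply: cvgM; [exact: cf|exact: cg]. Qed.

Lemma cont_onV a b f : (forall x, a <= x <= b -> f x != 0) ->
  cont_on a b f -> cont_on a b (fun t => (f t)^-1).
Proof. by move=> f0 cf x xab; apply: cvgV; [exact: f0|exact: cf]. Qed.

Lemma cont_on_cst a b (k : C) : cont_on a b (fun=> k).
Proof. by move=> x _; exact: cvg_cst. Qed.

Lemma cont_onX a b f n : cont_on a b f -> cont_on a b (fun t => f t ^+ n).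
Proof.
move=> cf; elim: n => [|n IH]; first exact: cont_on_cst.
by under [X in cont_on _ _ X]eq_fun do rewrite exprS; exact: cont_onM.
Qed.

Lemma eq_ci a b f g : (forall x, a <= x <= b -> f x = g x) -> ci a b f = ci a b g.
Proof.
move=> fg; rewrite /ci; congr Complex;
  apply: eq_Rintegral => x /[!inE] /= /[!in_itv] /= H;
  by rewrite fg.
Qed.

Lemma ciD a b f g : cont_on a b f -> cont_on a b g ->
  ci a b (fun t => f t + g t) = ci a b f + ci a b g.
Proof.
move=> /cont_on_integrable[f1 f2] /cont_on_integrable[g1 g2]; rewrite /ci.
apply/eqP; rewrite eq_complex /=.
under eq_Rintegral do rewrite ReD.
rewrite RintegralD // eqxx /=.
by under eq_Rintegral do rewrite ImD; rewrite RintegralD.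
Qed.

Lemma ciZ a b f (k : C) : cont_on a b f ->
  ci a b (fun t => k * f t) = k * ci a b f.
Proof.
move=> /cont_on_integrable[f1 f2]; rewrite /ci.
case: k => k1 k2; apply/eqP; rewrite eq_complex /=.
have re t : complex.Re ((k1 +i* k2) * f t : C) =
    k1 * complex.Re (f t) + (- k2) * complex.Im (f t).
  by case: (f t) => ? ? /=; rewrite mulNr.
have im t : complex.Im ((k1 +i* k2) * f t : C) =
    k1 * complex.Im (f t) + k2 * complex.Re (f t).
  by case: (f t) => ? ? /=.
have iZ (k : R) (u : R -> R) : mu.-integrable `[a, b] (EFin \o u) ->
  mu.-integrable `[a, b] (EFin \o (fun t => k * u t)).
  by move=> iu; apply: (integrableZl _ k) iu.
apply/andP; split; apply/eqP.
  under eq_Rintegral do rewrite re.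
  rewrite RintegralD ?RintegralZl //; try exact: iZ.
  by rewrite mulNr.
under eq_Rintegral do rewrite im.
by rewrite RintegralD ?RintegralZl //; try exact: iZ.
Qed.

Lemma ciB a b f g : cont_on a b f -> cont_on a b g ->
  ci a b (fun t => f t - g t) = ci a b f - ci a b g.
Proof.
move=> cf cg; have -> : (fun t => f t - g t) = (fun t => f t + (-1) * g t).
  by apply/funext => t; rewrite mulN1r.
rewrite ciD; last 2 first.
- exact: cf.
- by apply: cont_onM cg; exact: cont_on_cst.
by rewrite ciZ; [rewrite mulN1r|exact: cg].
Qed.

Lemma ci_sum a b (n : nat) (F : nat -> R -> C) : (forall k, cont_on a b (F k)) ->
  cont_on a b (fun t => \sum_(k < n) F k t) /\
  ci a b (fun t => \sum_(k < n) F k t) = \sum_(k < n) ci a b (F k).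
Proof.
move=> cF; elim: n => [|n [IH1 IH2]].
  have -> : (fun t => \sum_(k < 0) F k t) = (fun=> 0 : C).
    by apply/funext => t; rewrite big_ord0.
  split; first exact: cont_on_cst.
  rewrite big_ord0 -[RHS](mul0r (ci a b (fun=> 0))) -ciZ; last exact: cont_on_cst.
  by apply: eq_ci => x _; rewrite mul0r.
have -> : (fun t => \sum_(k < n.+1) F k t) = (fun t => \sum_(k < n) F k t + F n t).
  by apply/funext => t; rewrite big_ord_recr.
split; first by apply: cont_onD; [exact: IH1|exact: cF].
by rewrite big_ord_recr /= ciD; [rewrite IH2|exact: IH1|exact: cF].
Qed.

Lemma ci_split a b c f : a <= c -> c <= b -> cont_on a b f ->
  ci a b f = ci a c f + ci c b f.
Proof.
move=> ac cb cf; have [f1 f2] := cont_on_integrable cf.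
have [g1 g2] := cont_on_integrable (cont_on_sub ac (lexx b) cf).
apply/eqP; rewrite eq_complex /=; apply/andP; split; apply/eqP.
- rewrite -[X in _ + X]Rintegral_itv_obnd_cbnd; last first.
    by apply: integrableS g1 => //; exact: subset_itv_oc_cc.
  by rewrite -(Rintegral_itvB f1) ?bnd_simp // addrC subrK.
- rewrite -[X in _ + X]Rintegral_itv_obnd_cbnd; last first.
    by apply: integrableS g2 => //; exact: subset_itv_oc_cc.
  by rewrite -(Rintegral_itvB f2) ?bnd_simp // addrC subrK.
Qed.

Lemma itv_measure a b : a <= b -> fine (mu `[a, b]) = b - a.
Proof.
rewrite le_eqVlt => /predU1P[->|ab].
  by rewrite set_itv1 lebesgue_measure_set1 subrr.
by rewrite lebesgue_measure_itv /= lte_fin ab.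
Qed.

Lemma ci_cst a b (k : C) : a <= b -> ci a b (fun=> k) = k * (b - a)%:C.
Proof.
move=> ab; rewrite /ci !Rintegral_cst // itv_measure //.
by case: k => k1 k2; apply/eqP; rewrite eq_complex /= !mulr0 subr0 add0r !eqxx.
Qed.

(* The factor 2 comes from bounding real and imaginary parts separately. *)
Lemma ci_bound a b f (M : R) : a <= b -> cont_on a b f ->
  (forall x, a <= x <= b -> cabs (f x) <= M) ->
  cabs (ci a b f) <= 2 * M * (b - a).
Proof.
move=> ab cf fM; have [f1 f2] := cont_on_integrable cf.
have bd (u : R -> R) : mu.-integrable `[a, b] (EFin \o u) ->
    (forall x, a <= x <= b -> `|u x| <= M) ->
    `|Rintegral mu `[a, b] u| <= M * (b - a).
  move=> iu uM; apply: le_trans (le_normr_Rintegral _ iu) _ => //.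
  rewrite -(itv_measure ab) -Rintegral_cst //; apply: le_Rintegral => //.
  - exact: (integrable_norm iu).
  - apply: continuous_compact_integrable; first exact: segment_compact.
    by apply: continuous_subspaceT => x; exact: cvg_cst.
have -> : 2 * M * (b - a) = M * (b - a) + M * (b - a) by ring.
apply: le_trans (cabs_le_ReIm _) _; apply: lerD; apply: bd.
- exact: f1.
- by move=> x /fM; apply: le_trans; exact: cabs_Re.
- exact: f2.
- by move=> x /fM; apply: le_trans; exact: cabs_Im.
Qed.

Lemma FTC_cont a b (F f : R -> R) : a <= b -> (forall x, is_derive x 1 F (f x)) ->
  continuous f -> Rintegral mu `[a, b] f = F b - F a.
Proof.
rewrite le_eqVlt => /predU1P[<-|ab] dF cf.
  by rewrite set_itv1 Rintegral_set1 subrr.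
have cF : continuous F.
  move=> x; apply/differentiable_continuous; apply/derivable1_diffP.
  by have [] := dF x.
rewrite /Rintegral (@continuous_FTC2 _ _ F) //.
- exact: continuous_subspaceT.
- split; first by move=> x _; have [] := dF x.
  + by apply: cvg_at_right_filter; exact: cF.
  + by apply: cvg_at_left_filter; exact: cF.
- by move=> x _; rewrite derive1E; exact: derive_val.
Qed.

(** The factor ['i * k] stays inside the integrand so that [k = 0] needs no separate case; [k] is
    real so that differences of indices are allowed. *)
Lemma ci_expit a b (k : R) : a <= b ->
  ci a b (fun t => 'i * k%:C * expit (k * t)) = expit (k * b) - expit (k * a).
Proof.
move=> ab; have ck x : {for x, continuous (fun t : R => k * t)}.
  by apply: cvgM; [exact: cvg_cst|exact: cvg_id].
rewrite /ci; transitivity (Complex (cos (k * b) - cos (k * a))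
  (sin (k * b) - sin (k * a))); last by [].
congr Complex.
- have re t : complex.Re ('i * k%:C * expit (k * t) : C) = - k * sin (k * t).
    by rewrite /=; ring.
  under eq_Rintegral do rewrite re.
  apply: (FTC_cont (F := fun t => cos (k * t))) => // x.
  + by apply: is_derive_eq; rewrite /GRing.scale /=; ring.
  + apply: cvgM; first exact: cvg_cst.
    exact: (continuous_comp (ck x) (@continuous_sin R (k * x))).
- have im t : complex.Im ('i * k%:C * expit (k * t) : C) = k * cos (k * t).
    by rewrite /=; ring.
  under eq_Rintegral do rewrite im.
  apply: (FTC_cont (F := fun t => sin (k * t))) => // x.
  + by apply: is_derive_eq; rewrite /GRing.scale /=; ring.
  + apply: cvgM; first exact: cvg_cst.
    exact: (continuous_comp (ck x) (@continuous_cos R (k * x))).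
Qed.

(** The difference is the integral of a function of modulus 1; the 2 is the loss of [ci_bound], not
    the sharp constant. *)
Lemma expit_lip x y : cabs (expit x - expit y : C) <= 2 * `|x - y|.
Proof.
wlog xy : x y / y <= x.
  move=> H; have [/H//|/ltW/H] := leP y x; by rewrite cabsB distrC.
have := ci_expit 1 xy; rewrite !mul1r => <-.
rewrite ger0_norm ?subr_ge0 // -[2]mulr1; apply: ci_bound => //.
- apply: cont_onM; first exact: cont_on_cst.
  move=> z _; have -> : (fun t => expit (1 * t) : C) = (@expit R : R -> C).
    by apply/funext => t; rewrite mul1r.
  exact: cont_expit.
- by move=> z _; rewrite !cabsM cabsi cabs1 cabs_expit !mul1r.
Qed.

End ComplexIntegral.

(** * Goursat's subdivision for a function of rectangles *)

Section Quadrisection.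
Context {R : realType}.
Implicit Types (x l : R).

Lemma nested_intervals (x l : nat -> R) : (forall n, x n <= x n.+1) ->
  (forall n, x n.+1 + l n.+1 <= x n + l n) -> (forall n, 0 <= l n) ->
  exists c, forall n, x n <= c <= x n + l n.
Proof.
move=> x1 xl l0.
have xm : {homo x : m n / (m <= n)%N >-> m <= n} by apply/nondecreasing_seqP.
have xlm : {homo (fun n => x n + l n) : m n / (m <= n)%N >-> n <= m}.
  by apply/nonincreasing_seqP.
have ub k n : x k <= x n + l n.
  have [kn|/ltnW nk] := leqP k n.
    by apply: le_trans (xm _ _ kn) _; rewrite lerDl.
  by apply: le_trans (xlm _ _ nk); rewrite lerDl.
have hs : has_sup (range x).
  split; first by exists (x 0%N), 0%N.
  by exists (x 0%N + l 0%N) => _ [k _ <-].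
exists (sup (range x)) => n; apply/andP; split.
  by apply: sup_upper_bound => //; exists n.
by apply: sup_le_ub; [exact: hs.1|move=> _ [k _ <-]].
Qed.

Lemma half_pow_small (d : R) : 0 < d -> exists n, 2^-1 ^+ n < d.
Proof.
move=> d0; exists (Num.bound d^-1).
have /lt_trans : d^-1 < (Num.bound d^-1)%:R.
  by apply: archi_boundP; rewrite invr_ge0 ltW.
rewrite exprVn => /(_ (2 ^+ Num.bound d^-1)).
rewrite -natrX ltr_nat ltn_expl // => /(_ isT) H.
by rewrite invf_plt ?posrE // ltr0n expn_gt0.
Qed.

(** Here [m a A b B] is attached to the rectangle with corner [(a, b)] and sides [A], [B]. If the
    total is nonzero, some quarter keeps a quarter of its modulus at every stage, hence at least
    [M / 4 ^ n] after [n] stages. The nested quarters shrink to a point, and the local bound there,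
    with [e] small, is below that. *)
Lemma quadrisection (m : R -> R -> R -> R -> R[i]) (s S t T : R) :
  0 < S -> 0 < T ->
  (forall a A b B, s <= a -> 0 < A -> a + A <= s + S ->
     t <= b -> 0 < B -> b + B <= t + T ->
     m a A b B = m a (A / 2) b B + m (a + A / 2) (A / 2) b B /\
     m a A b B = m a A b (B / 2) + m a A (b + B / 2) (B / 2)) ->
  (forall x y, s <= x <= s + S -> t <= y <= t + T -> forall e, 0 < e ->
     exists2 d, 0 < d & forall a A b B, s <= a -> 0 < A -> a + A <= s + S ->
     t <= b -> 0 < B -> b + B <= t + T -> a <= x <= a + A -> b <= y <= b + B ->
     A < d -> B < d -> cabs (m a A b B) <= e * (A + B) ^+ 2) ->
  m s S t T = 0.
Proof.
move=> S0 T0 add loc; apply/eqP/negPn/negP => m0.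
set M := cabs (m s S t T).
have M0 : 0 < M by rewrite lt_neqAle eq_sym cabs_eq0 m0 cabs_ge0.
pose h n : R := 2^-1 ^+ n.
have h0 n : 0 < h n by rewrite exprn_gt0.
have hS n : h n.+1 = h n / 2 by rewrite /h exprSr.
(* [p] is the lower left corner of a rectangle of stage [n], whose sides are [S * h n] and
   [T * h n]. *)
pose good n (p : R * R) := [/\ s <= p.1, p.1 + S * h n <= s + S,
  t <= p.2, p.2 + T * h n <= t + T &
  M * h n ^+ 2 <= cabs (m p.1 (S * h n) p.2 (T * h n))].
pose next n (p q : R * R) := [/\ good n.+1 q, p.1 <= q.1,
  q.1 + S * h n.+1 <= p.1 + S * h n, p.2 <= q.2 &
  q.2 + T * h n.+1 <= p.2 + T * h n].
(* The hypothesis [good n p] stands under the existential so that the relation is total and [choice]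
   applies; a bad [p] gets a dummy successor. *)
have step n p : exists q, good n p -> next n p q.
  have [gp|ngp] := pselect (good n p); last by exists p.
  have [p1 p1' p2 p2' pm] := gp; case: p => a b /= in gp p1 p1' p2 p2' pm *.
  have A0 : 0 < S * h n by rewrite mulr_gt0.
  have B0 : 0 < T * h n by rewrite mulr_gt0.
  have A2 : S * h n.+1 = S * h n / 2 by rewrite hS mulrA.
  have B2 : T * h n.+1 = T * h n / 2 by rewrite hS mulrA.
  set A := S * h n in A0 A2 gp p1' pm *; set B := T * h n in B0 B2 gp p2' pm *.
  have E1 := (add a A b B p1 A0 p1' p2 B0 p2').1.
  have E2 : m a (A / 2) b B = m a (A / 2) b (B / 2) + m a (A / 2) (b + B / 2) (B / 2).
    by apply: (add _ _ _ _ _ _ _ _ _ _).2 => //; lra.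
  have E3 : m (a + A / 2) (A / 2) b B =
      m (a + A / 2) (A / 2) b (B / 2) + m (a + A / 2) (A / 2) (b + B / 2) (B / 2).
    by apply: (add _ _ _ _ _ _ _ _ _ _).2 => //; lra.
  have tri : cabs (m a A b B) <= cabs (m a (A / 2) b (B / 2)) +
      cabs (m a (A / 2) (b + B / 2) (B / 2)) +
      (cabs (m (a + A / 2) (A / 2) b (B / 2)) +
      cabs (m (a + A / 2) (A / 2) (b + B / 2) (B / 2))).
    rewrite E1 E2 E3; apply: le_trans (cabsD _ _) _.
    by apply: lerD; exact: cabsD.
  have Mh : M * h n.+1 ^+ 2 = M * h n ^+ 2 / 4 by rewrite hS; field.
  (* If three quarters fall short of a quarter of the modulus, [tri] forces the fourth to reach
     it. *)
  have : exists2 q : R * R, (q.1 = a \/ q.1 = a + A / 2) /\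
      (q.2 = b \/ q.2 = b + B / 2) &
      M * h n.+1 ^+ 2 <= cabs (m q.1 (A / 2) q.2 (B / 2)).
    rewrite Mh.
    have [k1|k1] := leP (M * h n ^+ 2 / 4) (cabs (m a (A / 2) b (B / 2))).
      by exists (a, b) => //=; split; left.
    have [k2|k2] := leP (M * h n ^+ 2 / 4) (cabs (m a (A / 2) (b + B / 2) (B / 2))).
      by exists (a, b + B / 2) => //=; split; [left|right].
    have [k3|k3] := leP (M * h n ^+ 2 / 4) (cabs (m (a + A / 2) (A / 2) b (B / 2))).
      by exists (a + A / 2, b) => //=; split; [right|left].
    exists (a + A / 2, b + B / 2); first by split; right.
    by rewrite /=; lra.
  case=> -[q1 q2] /= [Q1 Q2] Q; exists (q1, q2) => _.
  rewrite /next /good /= A2 B2 -/A -/B.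
  have halves (c u : R) : 0 < u ->
      [/\ c <= c + u / 2, c + u / 2 <= c + u & c + u / 2 + u / 2 = c + u].
    by move=> u0; split; lra.
  have [a1 a2 a3] := halves a A A0; have [b1 b2 b3] := halves b B B0.
  have a4 := le_trans p1 a1; have b4 := le_trans p2 b1.
  have a5 := le_trans a2 p1'; have b5 := le_trans b2 p2'.
  by case: Q1 Q2 Q => [->|->] [->|->] Q; rewrite ?a3 ?b3; split => //; split.
have [g gP] : exists g : nat * (R * R) -> R * R,
    forall np, good np.1 np.2 -> next np.1 np.2 (g np).
  have [|g gP] := @choice _ _ (fun (np : nat * (R * R)) q =>
    good np.1 np.2 -> next np.1 np.2 q); last by exists g.
  by move=> np; exact: step.
pose f := fix f n := if n is k.+1 then g (k, f k) else (s, t).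
have fg n : good n (f n).
  elim: n => [|n IH]; last by have [] := gP (n, f n) IH.
  by rewrite /good /= /h expr0 !mulr1 expr1n mulr1; split.
have fn n : next n (f n) (f n.+1) := gP (n, f n) (fg n).
have [x xP] : exists c, forall n, (f n).1 <= c <= (f n).1 + S * h n.
  by apply: nested_intervals => n;
    [have [] := fn n|have [] := fn n|rewrite mulr_ge0 // ltW].
have [y yP] : exists c, forall n, (f n).2 <= c <= (f n).2 + T * h n.
  by apply: nested_intervals => n;
    [have [] := fn n|have [] := fn n|rewrite mulr_ge0 // ltW].
have x0 : s <= x <= s + S by have := xP 0%N; rewrite /= /h expr0 mulr1.
have y0 : t <= y <= t + T by have := yP 0%N; rewrite /= /h expr0 mulr1.
have ST : 0 < (S + T) ^+ 2 by rewrite exprn_gt0 // addr_gt0.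
(* This [e] turns the local bound at stage [n] into [M * h n ^+ 2 / 2], half of what [good n]
   guarantees. *)
have [d d0 dP] := loc x y x0 y0 (M / 2 / (S + T) ^+ 2)
  (divr_gt0 (divr_gt0 M0 (ltr0Sn _ 1)) ST).
have [n nd] := half_pow_small (divr_gt0 d0 (addr_gt0 S0 T0)).
have nd' : (S + T) * h n < d by rewrite mulrC -ltr_pdivlMr ?addr_gt0.
have [f1 f1' f2 f2' fm] := fg n.
have hS0 : 0 < S * h n by rewrite mulr_gt0.
have hT0 : 0 < T * h n by rewrite mulr_gt0.
have := dP _ _ _ _ f1 hS0 f1' f2 hT0 f2' (xP n) (yP n).
have -> : M / 2 / (S + T) ^+ 2 * (S * h n + T * h n) ^+ 2 = M * h n ^+ 2 / 2.
  by field; rewrite gt_eqF // addr_gt0.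
have Mh0 : 0 < M * h n ^+ 2 by rewrite mulr_gt0 // exprn_gt0.
have Sn : S * h n < d by apply: le_lt_trans nd'; rewrite mulrDl lerDl ltW.
have Tn : T * h n < d by apply: le_lt_trans nd'; rewrite mulrDl lerDr ltW.
by move=> /(_ Sn Tn); lra.
Qed.

End Quadrisection.

(** * First-order expansion at a point of differentiability *)

Section ComplexDerivative.
Local Open Scope complex_scope.
Context {R : realType}.
Local Notation C := (Num.NumField.sort (R[i] : numFieldType)).
Implicit Types (h : R[i] -> R[i]) (z w : R[i]) (e d : R).

Lemma pos_complexP (e : R[i]) : 0 < e -> exists2 d : R, 0 < d & e = d%:C.
Proof.
move=> e0; exists (cabs e); last by rewrite -normCE gtr0_norm.
by rewrite lt_neqAle eq_sym cabs_eq0 gt_eqF // cabs_ge0.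
Qed.

(** Clearing the denominator of the difference quotient makes the estimate hold at [w = z] too, as
    needed when it is integrated over sides that may pass through [z]. *)
Lemma derivable_firstorder h z : derivable (h : R[i]^o -> R[i]^o) z 1 ->
  exists l : R[i], forall e, 0 < e -> exists2 d, 0 < d & forall w,
    cabs (w - z) < d -> cabs (h w - h z - l * (w - z)) <= e * cabs (w - z).
Proof.
move=> /cvg_ex[l /cvgrPdist_lt hl]; exists l => e e0.
have /nbhs_ballP[d /= /pos_complexP[d' d'0 ->] dP] :
  (\forall t \near (0 : R[i]^o)^',
      `|l - t^-1 *: ((h \o shift z) (t *: 1) - h z)| < e%:C)
  by apply: hl; rewrite ltcR.
exists d' => // w wd.
have [->|wz] := eqVneq w z; first by rewrite !subrr mulr0 subrr cabs0 mulr0.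
have wz0 : w - z != 0 by rewrite subr_eq0.
have wb : ball (0 : R[i]^o) d'%:C (w - z : R[i]^o).
  rewrite -ball_normE /ball_ /= distrC subr0.
  by rewrite [`|_|](_ : _ = (cabs (w - z))%:C) ?ltcR // -normCE.
have := dP _ wb wz0; rewrite [`|_ - _|]normCE ltcR.
rewrite /shift /= /GRing.scale /= mulr1 subrK => H.
have -> : h w - h z - l * (w - z) =
    - ((w - z) * (l - (w - z)^-1 * (h w - h z))).
  by field.
by rewrite cabsN cabsM mulrC ler_wpM2r ?cabs_ge0 // ltW.
Qed.

Lemma derivable_cont h (f : R -> C) x : derivable (h : R[i]^o -> R[i]^o) (f x) 1 ->
  {for x, continuous f} -> {for x, continuous (fun y => h (f y) : C)}.
Proof.
move=> /derivable1_diffP /differentiable_continuous ch cf.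
exact: (continuous_comp cf ch).
Qed.

End ComplexDerivative.

(** * Cauchy's formula on a circle, by contraction onto the point *)

Section Homotopy.
Local Open Scope complex_scope.
Context {R : realType}.
Local Notation C := (Num.NumField.sort (R[i] : numFieldType)).
Variables (r : R) (z0 : R[i]).
Hypotheses (r0 : 0 < r) (r1 : r < 1) (z0r : cabs z0 < r).
Implicit Types (g : R[i] -> R[i]) (s t u v : R).

Definition circ t : C := r%:C * expit t.
Let spoke t : C := circ t - z0.
Let ray s t : C := z0 + s%:C * spoke t.
(** Along [ray s], [dw] is [s * 'i * circ t dt] and [w - z0] is [s * spoke t]. The [s] cancels, so
    this kernel stays bounded while the circle shrinks to [z0]. *)
Let kappa t : C := 'i * circ t / spoke t.
Let gap := r - cabs z0.

Let gap0 : 0 < gap. Proof. by rewrite subr_gt0. Qed.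

Lemma cabs_circ t : cabs (circ t) = r.
Proof. by rewrite cabsM cabs_expit mulr1 cabs_realC gtr0_norm. Qed.

Lemma circ_neq0 t : circ t != 0.
Proof. by rewrite -cabs_eq0 cabs_circ gt_eqF. Qed.

Let spoke_ge t : gap <= cabs (spoke t).
Proof. by rewrite /gap -(cabs_circ t); exact: cabs_triB. Qed.

Let spoke_le t : cabs (spoke t) <= 2.
Proof.
apply: le_trans (cabsD _ _) _; rewrite cabsN cabs_circ.
by have := ltW z0r; have := ltW r1; lra.
Qed.

Let spoke_neq0 t : spoke t != 0.
Proof. by rewrite -cabs_eq0 gt_eqF // (lt_le_trans gap0). Qed.

Lemma cauchy_kernel_le t :
  cabs ('i * circ t / (circ t - z0)) <= (r - cabs z0)^-1.
Proof.
rewrite cabsM cabsV (cabsM 'i) cabsi mul1r cabs_circ -[leRHS]mul1r.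
apply: ler_pM; rewrite ?invr_ge0 ?cabs_ge0 ?(ltW r0) ?(ltW r1) //.
by rewrite lef_pV2 ?posrE ?(lt_le_trans gap0) //; exact: spoke_ge.
Qed.

Let ray_disc s t : 0 <= s <= 1 -> cabs (ray s t) < 1.
Proof.
move=> /andP[s0 s1]; apply: le_lt_trans r1.
have -> : ray s t = (1 - s)%:C * z0 + s%:C * circ t.
  by rewrite /ray /spoke rmorphB /=; ring.
apply: le_trans (cabsD _ _) _.
rewrite (cabsM _ z0) (cabsM _ (circ t)) cabs_circ !cabs_realC.
rewrite !ger0_norm ?subr_ge0 //.
have : (1 - s) * cabs z0 <= (1 - s) * r by rewrite ler_wpM2l ?subr_ge0 // ltW.
by lra.
Qed.

Let cont_realM (k : C) s : {for s, continuous (fun u => u%:C * k : C)}.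
Proof. by apply: cvgM; [exact: cont_realC|exact: cvg_cst]. Qed.

Lemma cont_circ t : {for t, continuous circ}.
Proof. by apply: cvgM; [exact: cvg_cst|exact: cont_expit]. Qed.

Let cont_spoke t : {for t, continuous spoke}.
Proof. by apply: cvgB; [exact: cont_circ|exact: cvg_cst]. Qed.

Lemma cont_cauchy_kernel t :
  {for t, continuous (fun v => 'i * circ v / (circ v - z0) : C)}.
Proof.
apply: cvgM; last by apply: cvgV; [exact: spoke_neq0|exact: cont_spoke].
by apply: cvgM; [exact: cvg_cst|exact: cont_circ].
Qed.

Let cont_kappa t : {for t, continuous kappa}.
Proof. exact: cont_cauchy_kernel. Qed.

Let kappa_le t : cabs (kappa t) <= gap^-1.
Proof. exact: cauchy_kernel_le. Qed.

Let cont_rayl s t : {for s, continuous (fun u => ray u t)}.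
Proof. by apply: cvgD; [exact: cvg_cst|exact: cont_realM]. Qed.

Let cont_rayr s t : {for t, continuous (fun v => ray s v)}.
Proof.
apply: cvgD; first exact: cvg_cst.
by apply: cvgM; [exact: cvg_cst|exact: cont_spoke].
Qed.

(** Separate continuity is enough, since each side integral moves only one of the two parameters. *)
Let cont_ray g := (forall s t, 0 <= s <= 1 ->
    {for s, continuous (fun u => g (ray u t) : C)}) /\
  (forall s t, 0 <= s <= 1 -> {for t, continuous (fun v => g (ray s v) : C)}).

Let side_s g t a b := ci a b (fun u => g (ray u t) * (u%:C)^-1 : C).
Let side_t g s a b := ci a b (fun v => g (ray s v) * kappa v : C).

(* [bdry g s A t B] is the integral of [g w dw / (w - z0)] along the image under
   [ray] of the boundary of [s, s + A] x [t, t + B]: on the sides where [s] varies,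
   [dw / (w - z0) = ds / s]; on those where [t] varies, it is [kappa t dt]. *)
Let bdry g s A t B := side_s g t s (s + A) - side_s g (t + B) s (s + A) +
  side_t g (s + A) t (t + B) - side_t g s t (t + B).

Let cont_side_s g t a b : cont_ray g -> 0 < a -> b <= 1 ->
  cont_on a b (fun u => g (ray u t) * (u%:C)^-1 : C).
Proof.
move=> [gs _] a0 b1 x /andP[ax xb].
have x0 := lt_le_trans a0 ax.
apply: cvgM; first by apply: gs; rewrite (ltW x0) (le_trans xb b1).
apply: cvgV; last exact: cont_realC.
by rewrite -cabs_eq0 cabs_realC gt_eqF // normr_gt0 gt_eqF.
Qed.

Let cont_side_t g s a b : cont_ray g -> 0 <= s <= 1 ->
  cont_on a b (fun v => g (ray s v) * kappa v : C).
Proof.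
move=> [_ gt] s01 x _; apply: cvgM; first exact: gt.
exact: cont_kappa.
Qed.

Let bdryD g1 g2 s A t B : cont_ray g1 -> cont_ray g2 -> 0 < s -> 0 < A ->
  s + A <= 1 -> bdry (fun z => g1 z + g2 z) s A t B = bdry g1 s A t B + bdry g2 s A t B.
Proof.
move=> c1 c2 s0 A0 A1.
have sS t' : side_s (fun z => g1 z + g2 z) t' s (s + A) =
    side_s g1 t' s (s + A) + side_s g2 t' s (s + A).
  rewrite /side_s -ciD; try exact: cont_side_s.
  by apply: eq_ci => x _; rewrite mulrDl.
have tS s' : 0 <= s' <= 1 -> side_t (fun z => g1 z + g2 z) s' t (t + B) =
    side_t g1 s' t (t + B) + side_t g2 s' t (t + B).
  move=> s01; rewrite /side_t -ciD; try exact: cont_side_t.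
  by apply: eq_ci => x _; rewrite mulrDl.
rewrite /bdry !sS !tS; [by ring|lra|lra].
Qed.

Let ci_circ a b : a <= b -> ci a b (fun t => 'i * circ t) = circ b - circ a.
Proof.
move=> ab; have ce : cont_on a b (fun t => 'i * expit t : C).
  by move=> x _; apply: cvgM; [exact: cvg_cst|exact: cont_expit].
have := ci_expit 1 ab; rewrite !mul1r /circ -mulrBr => <-.
have -> : (fun t => 'i * (1 : R)%:C * expit (1 * t) : C) = (fun t => 'i * expit t).
  by apply/funext => t; rewrite mul1r mulr1.
by rewrite -ciZ //; apply: eq_ci => x _; ring.
Qed.

(* The form [(a + b w) dw / (w - z0)] is exact on the homotopy. *)
Let bdry_affine (a b : R[i]) s A t B : 0 < s -> 0 < A -> s + A <= 1 -> 0 < B ->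
  bdry (fun z => a + b * z) s A t B = 0.
Proof.
move=> s0 A0 A1 B0; have sA : s <= s + A by lra.
have tB : t <= t + B by lra.
have cI : cont_on s (s + A) (fun u => (u%:C)^-1 : C).
  move=> x /andP[sx _]; apply: cvgV; last exact: cont_realC.
  by rewrite -cabs_eq0 cabs_realC normr_eq0 gt_eqF // (lt_le_trans s0).
(* The singular part [(a + b * z0) / u] is free of [t'], and its counterpart in [tS] is free of
   [s'], so both cancel between opposite sides. What remains is [b] times [A] times the increment of
   [circ], once with each sign. *)
have sS t' : side_s (fun z => a + b * z) t' s (s + A) =
    (a + b * z0) * ci s (s + A) (fun u => (u%:C)^-1) + b * spoke t' * A%:C.
  have -> : b * spoke t' * A%:C = ci s (s + A) (fun=> b * spoke t').
    by rewrite ci_cst //; congr (_ * _%:C); ring.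
  rewrite -ciZ; last exact: cI.
  rewrite -ciD; last 2 first.
  - by apply: cont_onM cI; exact: cont_on_cst.
  - exact: cont_on_cst.
  apply: eq_ci => x /andP[sx _]; rewrite /ray.
  have x0 : x%:C != 0 :> R[i].
    by rewrite -cabs_eq0 cabs_realC normr_eq0 gt_eqF // (lt_le_trans s0).
  by field.
have ck : cont_on t (t + B) kappa by move=> x _; exact: cont_kappa.
have cc : cont_on t (t + B) (fun v => 'i * circ v : C).
  by move=> x _; apply: cvgM; [exact: cvg_cst|exact: cont_circ].
have tS s' : side_t (fun z => a + b * z) s' t (t + B) =
    (a + b * z0) * ci t (t + B) kappa + b * s'%:C * (circ (t + B) - circ t).
  rewrite -ci_circ // -ciZ; last exact: ck.
  rewrite -ciZ; last exact: cc.
  rewrite -ciD; last 2 first.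
  - by apply: cont_onM ck; exact: cont_on_cst.
  - by apply: cont_onM cc; exact: cont_on_cst.
  apply: eq_ci => x _; rewrite /ray /kappa.
  by have := spoke_neq0 x; move=> ?; field.
by rewrite /bdry !sS !tS /spoke rmorphD /=; ring.
Qed.

Variable h : R[i] -> R[i].
Hypothesis hol : holomorphic_on (@udisc R) h.

Let cont_ray_h : cont_ray h.
Proof.
split=> s t s01; apply: derivable_cont; try exact: cont_rayl; try exact: cont_rayr.
  by apply: hol; apply/udiscP; exact: ray_disc.
by apply: hol; apply/udiscP; exact: ray_disc.
Qed.

Let cont_ray_affine (a b : R[i]) : cont_ray (fun z => a + b * z).
Proof.
by split=> s t s01; apply: cvgD; try exact: cvg_cst; apply: cvgM;
  try exact: cvg_cst; [exact: cont_rayl|exact: cont_rayr].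
Qed.

Let ray_lip s t s' t' : 0 <= s' <= 1 ->
  cabs (ray s t - ray s' t') <= 2 * (`|s - s'| + `|t - t'|).
Proof.
move=> /andP[s0 s1].
have -> : ray s t - ray s' t' =
    (s - s')%:C * spoke t + s'%:C * r%:C * (expit t - expit t').
  by rewrite /ray /spoke /circ rmorphB /=; ring.
apply: le_trans (cabsD _ _) _; rewrite !cabsM !cabs_realC mulrDr; apply: lerD.
  by rewrite mulrC ler_wpM2r.
rewrite -[leRHS]mul1r; apply: ler_pM; rewrite ?mulr_ge0 ?cabs_ge0 //.
  by rewrite -[1]mulr1; apply: ler_pM => //; rewrite ger0_norm // ltW.
exact: expit_lip.
Qed.

(** Near a point, [h] is an affine function plus a remainder small compared with the distance. The
    affine part contributes nothing by [bdry_affine]; the remainder is of order [e * (A + B)] on a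
    perimeter of order [A + B]. Keeping [s] positive bounds the kernel [1 / u] of the radial
    sides. *)
Let bdry_h0 s : 0 < s < 1 -> bdry h s (1 - s) 0 (2 * pi) = 0.
Proof.
move=> /andP[s0 s1]; apply: quadrisection.
- by rewrite subr_gt0.
- by rewrite mulr_gt0 // pi_gt0.
- move=> a A b B sa A0 aA tb B0 bB.
  have a0 : 0 < a := lt_le_trans s0 sa.
  have E1 c : c + B / 2 + B / 2 = c + B by field.
  have E2 c : c + A / 2 + A / 2 = c + A by field.
  have sS t : side_s h t a (a + A) =
      side_s h t a (a + A / 2) + side_s h t (a + A / 2) (a + A).
    by apply: ci_split; [lra|lra|apply: cont_side_s => //; lra].
  have tS s' : 0 <= s' <= 1 -> side_t h s' b (b + B) =
      side_t h s' b (b + B / 2) + side_t h s' (b + B / 2) (b + B).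
    by move=> s01; apply: ci_split; [lra|lra|exact: (cont_side_t cont_ray_h)].
  rewrite /bdry E1 E2; split; first by rewrite !sS; ring.
  by rewrite !tS; [ring|lra|lra].
- move=> x y /andP[x0 x1] /andP[y0 y1] e e0.
  have x01 : 0 <= x <= 1 by lra.
  have [l lP] := derivable_firstorder (hol ((udiscP _).2 (ray_disc y x01))).
  (* [K] dominates the kernel on both kinds of sides. The 8 below is 2 from [ray_lip], 2 from
     [ci_bound] and 2 sides of each kind. *)
  pose K := s^-1 + gap^-1.
  have K0 : 0 < K by rewrite addr_gt0 ?invr_gt0.
  have e'0 : 0 < e / (8 * K) by rewrite divr_gt0 // mulr_gt0.
  have [d d0 dP] := lP _ e'0.
  (* By [ray_lip] the image of the rectangle lies within [2 * (A + B)] of the image of [(x, y)],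
     which is then less than [d]. *)
  exists (d / 4); first by rewrite divr_gt0.
  move=> a A b B sa A0 aA tb B0 bB /andP[ax xA] /andP[byy yB] Ad Bd.
  have a0 : 0 < a := lt_le_trans s0 sa.
  have aA1 : a + A <= 1 by lra.
  (* [p] is the first-order polynomial of [h] at [ray x y] and [q] is [h - p]; both are spelled so
     that their affine parts have the shape [a + b * z]. *)
  pose p z := (h (ray x y) - l * ray x y) + l * z.
  pose q z := h z + ((l * ray x y - h (ray x y)) + (- l) * z).
  have cq : cont_ray q.
    split=> s' t' s01; apply: cvgD.
    - exact: (cont_ray_h.1 s' t' s01).
    - exact: ((cont_ray_affine _ _).1 s' t' s01).
    - exact: (cont_ray_h.2 s' t' s01).
    - exact: ((cont_ray_affine _ _).2 s' t' s01).
  have -> : h = (fun z => q z + p z) by apply/funext => z; rewrite /q /p; ring.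
  rewrite (bdryD _ _ cq (cont_ray_affine _ _) a0 A0 aA1).
  rewrite (bdry_affine _ _ _ a0 A0 aA1 B0) addr0.
  have qle a' b' : a <= a' <= a + A -> b <= b' <= b + B ->
      cabs (q (ray a' b')) <= e / (8 * K) * (2 * (A + B)).
    move=> /andP[aa' a'A] /andP[bb' b'B].
    have rr : cabs (ray a' b' - ray x y) <= 2 * (A + B).
      apply: le_trans (ray_lip _ _ _ x01) _; rewrite ler_pM2l //.
      by apply: lerD; rewrite ler_norml; lra.
    have -> : q (ray a' b') = h (ray a' b') - h (ray x y) - l * (ray a' b' - ray x y).
      by rewrite /q; ring.
    apply: le_trans (dP _ _) _; first by apply: le_lt_trans rr _; lra.
    by rewrite ler_wpM2l // ltW.
  set Q := e / (8 * K) * (2 * (A + B)) in qle.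
  have Q0 : 0 <= Q by rewrite /Q mulr_ge0 ?ltW //; rewrite mulr_gt0 // addr_gt0.
  have sle t' : b <= t' <= b + B -> cabs (side_s q t' a (a + A)) <= 2 * (Q / s) * A.
    move=> tt; have AA : A = a + A - a by rewrite addrC addKr.
    rewrite [in leRHS]AA; apply: ci_bound; first lra.
      exact: (cont_side_s cq a0 aA1).
    move=> u /andP[au uA]; have u0 := lt_le_trans a0 au.
    rewrite cabsM cabsV cabs_realC gtr0_norm //; apply: ler_pM.
    - exact: cabs_ge0.
    - by rewrite invr_ge0 ltW.
    - by apply: qle => //; rewrite au.
    - by rewrite lef_pV2 ?posrE // (le_trans sa).
  have tle s' : a <= s' <= a + A -> cabs (side_t q s' b (b + B)) <= 2 * (Q / gap) * B.
    move=> ss; have BB : B = b + B - b by rewrite addrC addKr.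
    rewrite [in leRHS]BB; apply: ci_bound; first lra.
      by apply: (cont_side_t cq); lra.
    move=> v /andP[bv vB].
    rewrite cabsM; apply: ler_pM; rewrite ?cabs_ge0 //.
    by apply: qle => //; rewrite bv.
  have i1 : b <= b <= b + B by lra.
  have i2 : b <= b + B <= b + B by lra.
  have i3 : a <= a <= a + A by lra.
  have i4 : a <= a + A <= a + A by lra.
  have /le_trans : cabs (bdry q a A b B) <=
      2 * (Q / s) * A + 2 * (Q / s) * A + 2 * (Q / gap) * B + 2 * (Q / gap) * B.
    rewrite /bdry; apply: le_trans (cabsD _ _) _; rewrite cabsN lerD ?tle //.
    apply: le_trans (cabsD _ _) _; rewrite lerD ?tle //.
    by apply: le_trans (cabsD _ _) _; rewrite cabsN lerD ?sle.
  apply.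
  have -> : e * (A + B) ^+ 2 = 4 * Q * K * (A + B).
    by rewrite /Q; field; rewrite gt_eqF.
  have s'0 : 0 <= s^-1 by rewrite invr_ge0 ltW.
  have g'0 : 0 <= gap^-1 by rewrite invr_ge0 ltW.
  have H1 : 0 <= Q * s^-1 * B := mulr_ge0 (mulr_ge0 Q0 s'0) (ltW B0).
  have H2 : 0 <= Q * gap^-1 * A := mulr_ge0 (mulr_ge0 Q0 g'0) (ltW A0).
  by rewrite /K; lra.
Qed.

Lemma circ_2pi : circ (2 * pi) = circ 0.
Proof. by rewrite /circ expit2pi expit0. Qed.

(** By [bdry_h0] the integral over the circle equals the one over each contracted circle, and [h]
    tends to [h z0] there as [s] tends to 0. The integral on the right is left unevaluated until
    [winding_number]. *)
Lemma cauchy_winding :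
  ci 0 (2 * pi) (fun v => h (circ v) * ('i * circ v / (circ v - z0)) : C) =
  h z0 * ci 0 (2 * pi) (fun v => 'i * circ v / (circ v - z0)).
Proof.
have pi0 : 0 < 2 * pi :> R by rewrite mulr_gt0 // pi_gt0.
have ray1 v : ray 1 v = circ v by rewrite /ray /spoke mul1r addrC subrK.
have shrink s : 0 < s < 1 -> ci 0 (2 * pi) (fun v => h (circ v) * kappa v : C) =
    ci 0 (2 * pi) (fun v => h (ray s v) * kappa v : C).
  move=> s01; have := bdry_h0 s01.
  rewrite /bdry add0r (addrC s) subrK.
  (* The radial sides at [t = 0] and [t = 2 * pi] have the same image and cancel. *)
  have -> : side_s h (2 * pi) = side_s h 0.
    by apply/funext => a; rewrite /side_s /ray /spoke circ_2pi.
  rewrite subrr add0r => /eqP; rewrite subr_eq0 => /eqP E.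
  transitivity (side_t h 1 0 (2 * pi)); last exact: E.
  by apply: eq_ci => v _; rewrite ray1.
have z01 : udisc z0 by apply/udiscP/(lt_trans z0r).
have [l lP] := derivable_firstorder (hol z01).
(* Only a Lipschitz bound at [z0] is wanted, with constant [cabs l + 1], so rate 1 will do. *)
have [d d0 dP] := lP 1 ltr01.
apply/eqP; rewrite -subr_eq0 -cabs_eq0 -(inj_eq (@complexI R)).
apply/eqP; congr (_%:C); apply/eqP; rewrite eq_le cabs_ge0 andbT.
pose K := 2 * (2 * (cabs l + 1) / gap) * (2 * pi).
have l1 : 0 < cabs l + 1 by rewrite ltr_wpDl ?cabs_ge0.
have K0 : 0 < K.
  by apply: mulr_gt0 pi0; rewrite mulr_gt0 // divr_gt0 // mulr_gt0.
apply/ler_addgt0Pl => e e0; rewrite addr0.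
(* The three terms ensure in turn [s < 1], the range [2 * s < d] of the Lipschitz bound, and a final
   error of at most [e]. *)
pose s := Num.min (1 / 2) (Num.min (d / 4) (e / K)).
have s0 : 0 < s by rewrite !lt_min !divr_gt0.
have s1 : s < 1 by rewrite gt_min; apply/orP; left; lra.
have sd : 2 * s < d.
  have : s <= d / 4 by rewrite !ge_min lexx orbT.
  by lra.
have se : s * K <= e.
  by rewrite -ler_pdivlMr // !ge_min lexx !orbT.
have s01 : 0 < s < 1 by rewrite s0.
have s01' : 0 <= s <= 1 by rewrite !ltW.
apply: le_trans se; rewrite (shrink s s01).
have ck : cont_on 0 (2 * pi) kappa by move=> x _; exact: cont_kappa.
have ch : cont_on 0 (2 * pi) (fun v => h z0 * kappa v : C).
  by apply: cont_onM ck; exact: cont_on_cst.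
have cs : cont_on 0 (2 * pi) (fun v => h (ray s v) * kappa v : C).
  exact: (cont_side_t cont_ray_h s01').
rewrite -ciZ; last exact: ck.
rewrite -ciB; last 2 first.
- exact: cs.
- exact: ch.
have -> : s * K = 2 * (2 * s * (cabs l + 1) / gap) * (2 * pi - 0).
  by rewrite /K; field; rewrite gt_eqF.
apply: ci_bound; first exact: ltW.
  apply: cont_onD; first exact: cs.
  by move=> x x01; apply: cvgN; exact: ch.
move=> v _; rewrite -mulrBl cabsM; apply: ler_pM; rewrite ?cabs_ge0 //.
have rz : cabs (ray s v - z0) <= 2 * s.
  rewrite /ray (addrC z0) addrK cabsM cabs_realC gtr0_norm // mulrC.
  by rewrite ler_wpM2r // ltW.
have := dP _ (le_lt_trans rz sd); rewrite mul1r => H.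
have -> : h (ray s v) - h z0 =
    (h (ray s v) - h z0 - l * (ray s v - z0)) + l * (ray s v - z0) by ring.
apply: le_trans (cabsD _ _) _; rewrite cabsM.
have : cabs l * cabs (ray s v - z0) <= cabs l * (2 * s).
  by rewrite ler_wpM2l ?cabs_ge0.
by lra.
Qed.

End Homotopy.

(** * Power series expansion on a smaller disc *)

Section Taylor.
Local Open Scope complex_scope.
Context {R : realType}.
Local Notation C := (Num.NumField.sort (R[i] : numFieldType)).
Local Notation twopi := (2 * pi : R).
Implicit Types (h : R[i] -> R[i]) (z : R[i]) (r : R) (n k : nat).

(** The passage to the limit used from here on: identities are obtained by applying it to the
    modulus of a difference. *)
Lemma geometric_le0 (x c q : R) : 0 <= q < 1 -> (forall n, x <= c * q ^+ n) -> x <= 0.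
Proof.
move=> /andP[q0 q1] H; have qn : (fun n => c * q ^+ n) @ \oo --> c * 0.
  by apply: cvgM; [exact: cvg_cst|apply: cvg_expr; rewrite ger0_norm].
rewrite mulr0 in qn; rewrite -(cvg_lim _ qn) //.
apply: limr_ge; first by apply/cvg_ex; exists 0.
by near=> n; exact: H.
Unshelve. all: by end_near. Qed.

Lemma twopi_gt0 : 0 < twopi.
Proof. by rewrite mulr_gt0 // pi_gt0. Qed.

Lemma expit_natpi n : expit (n%:R * twopi) = 1 :> R[i].
Proof. by rewrite -expitMn expit2pi expr1n. Qed.

Lemma cont_expitM (c : R) a b : cont_on a b (fun t => expit (c * t) : C).
Proof.
move=> x _.
have cc : {for x, continuous (fun t : R => c * t)}.
  by apply: cvgM; [exact: cvg_cst|exact: cvg_id].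
exact: (continuous_comp cc (cont_expit (x := c * x))).
Qed.

(** For distinct indices, [ci_expit] at frequency [j - k] vanishes by periodicity, and its nonzero
    factor can be cancelled. *)
Lemma ci_expit_orth (j k : nat) :
  ci 0 twopi (fun t => expit (j%:R * t) / expit (k%:R * t) : C) =
  (if j == k then twopi else 0)%:C.
Proof.
case: eqVneq => [->|jk].
  rewrite -[twopi in RHS]subr0 -[RHS]mul1r -ci_cst; last by rewrite ltW ?twopi_gt0.
  by apply: eq_ci => t _; rewrite divff ?expit_neq0.
have m0 : (j%:R - k%:R : R)%:C != 0 :> R[i].
  rewrite -cabs_eq0 cabs_realC normr_eq0 subr_eq0.
  by rewrite (inj_eq (mulrIn (oner_neq0 R))).
have i0 : 'i != 0 :> R[i] by rewrite -cabs_eq0 cabsi oner_neq0.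
have := @ci_expit R 0 twopi (j%:R - k%:R) (ltW twopi_gt0).
rewrite mulr0 expit0 mulrBl expitD expitN !expit_natpi invr1 mulr1 subrr.
rewrite ciZ; last exact: cont_expitM.
move=> /eqP; rewrite mulf_eq0 mulf_eq0 (negbTE i0) (negbTE m0) /= => /eqP E.
rewrite [RHS](_ : _ = 0) // -E.
by apply: eq_ci => t _; rewrite mulrBl expitD expitN.
Qed.

Lemma circXV r t k : (circ r t ^+ k)^-1 = (r%:C ^+ k)^-1 * (expit (k%:R * t))^-1.
Proof. by rewrite /circ exprMn expitMn invfM. Qed.

Section Radius.
Variables (r : R) (h : R[i] -> R[i]).
Hypotheses (r0 : 0 < r) (r1 : r < 1) (hol : holomorphic_on (@udisc R) h).

Lemma cont_hcirc a b : cont_on a b (fun v => h (circ r v) : C).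
Proof.
move=> x _; apply: derivable_cont; last exact: cont_circ.
by apply: hol; apply/udiscP; rewrite cabs_circ.
Qed.

Lemma cont_hcircV a b k : cont_on a b (fun v => h (circ r v) * (circ r v ^+ k)^-1 : C).
Proof.
apply: cont_onM; first exact: cont_hcirc.
apply: cont_onV; first by move=> x _; rewrite expf_neq0 ?circ_neq0.
by apply: cont_onX => x _; exact: cont_circ.
Qed.

Lemma bound_hcirc : exists M, forall v, 0 <= v <= twopi -> cabs (h (circ r v)) <= M.
Proof.
have [|c _ cP] := @EVT_max R (fun v => cabs (h (circ r v))) 0 twopi (ltW twopi_gt0).
  apply: continuous_in_subspaceT => x /[!inE] /= /[!in_itv] /= x02.
  exact: (cont_ReIm (cont_hcirc x02)).2.2.
by exists (cabs (h (circ r c))) => v v0; apply: cP; rewrite in_itv.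
Qed.

(** The Cauchy kernel is a finite geometric sum in [z / circ r v] plus a remainder carrying the
    factor [(z / circ r v) ^+ n]. The winding integral remains a factor because this lemma, taken at
    [h = 1], is what evaluates it. *)
Lemma cauchy_expansion z n M : cabs z < r ->
  (forall v, 0 <= v <= twopi -> cabs (h (circ r v)) <= M) ->
  cabs (h z * ci 0 twopi (fun v => 'i * circ r v / (circ r v - z)) -
    'i * \sum_(k < n) z ^+ k *
      ci 0 twopi (fun v => h (circ r v) * (circ r v ^+ k)^-1)) <=
  2 * (M * (cabs z / r) ^+ n / (r - cabs z)) * twopi.
Proof.
move=> zr hM; rewrite -cauchy_winding // mulr_sumr.
pose F k v : C := 'i * z ^+ k * (h (circ r v) * (circ r v ^+ k)^-1).
have cF k : cont_on 0 twopi (F k).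
  by apply: cont_onM; [exact: cont_on_cst|exact: cont_hcircV].
have -> : \sum_(k < n) 'i * (z ^+ k *
      ci 0 twopi (fun v => h (circ r v) * (circ r v ^+ k)^-1)) =
    ci 0 twopi (fun v => \sum_(k < n) F k v).
  rewrite (ci_sum n cF).2; apply: eq_bigr => k _.
  by rewrite /F ciZ ?mulrA //; exact: cont_hcircV.
have ck : cont_on 0 twopi
    (fun v => h (circ r v) * ('i * circ r v / (circ r v - z)) : C).
  by apply: cont_onM; [exact: cont_hcirc|move=> x _; exact: cont_cauchy_kernel].
rewrite -ciB; [|exact: ck|exact: (ci_sum n cF).1].
rewrite -[in leRHS](subr0 twopi); apply: ci_bound; first exact: ltW twopi_gt0.
  apply: cont_onD; first exact: ck.
  by move=> x x0; apply: cvgN; exact: ((ci_sum n cF).1 x x0).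
move=> v v0; have c0 := circ_neq0 r0 v.
have s0 : circ r v - z != 0.
  by rewrite subr_eq0; apply: contraTneq zr => <-; rewrite cabs_circ // ltxx.
have -> : h (circ r v) * ('i * circ r v / (circ r v - z)) - \sum_(k < n) F k v =
    h (circ r v) * (z / circ r v) ^+ n * ('i * circ r v / (circ r v - z)).
  elim: n {cF ck} => [|n IH]; first by rewrite big_ord0 expr0 subr0 mulr1.
  rewrite big_ord_recr /= opprD addrA IH /F !expr_div_n exprS [circ r v ^+ n.+1]exprS.
  have cn0 : circ r v ^+ n != 0 by rewrite expf_neq0.
  by field; rewrite c0 s0 cn0.
rewrite cabsM; apply: ler_pM; rewrite ?cabs_ge0 //; last exact: cauchy_kernel_le.
rewrite cabsM cabsX cabsM cabsV cabs_circ //; apply: ler_pM; rewrite ?cabs_ge0 //.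
- by rewrite exprn_ge0 // divr_ge0 ?cabs_ge0 // ltW.
- exact: hM.
Qed.

End Radius.

Lemma ci_circV r k : 0 < r ->
  ci 0 twopi (fun v => (circ r v ^+ k)^-1) = (if k == 0%N then twopi else 0)%:C.
Proof.
move=> r0; rewrite eq_sym.
have ck : cont_on 0 twopi (fun t => expit (0%:R * t) / expit (k%:R * t) : C).
  apply: cont_onM; first exact: cont_expitM.
  by apply: cont_onV; [move=> x _; exact: expit_neq0|exact: cont_expitM].
have -> : ci 0 twopi (fun v => (circ r v ^+ k)^-1) =
    ci 0 twopi (fun t => (r%:C ^+ k)^-1 * (expit (0%:R * t) / expit (k%:R * t))).
  by apply: eq_ci => v _; rewrite circXV mul0r expit0 mul1r.
rewrite ciZ; last exact: ck.
rewrite ci_expit_orth; case: eqVneq => [<-|_]; last by rewrite mulr0.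
by rewrite expr0 invr1 mul1r.
Qed.

(** In the expansion of the constant 1 only the term [k = 0] survives, by [ci_circV], and the
    remainder tends to 0. *)
Lemma winding_number r z : 0 < r < 1 -> cabs z < r ->
  ci 0 twopi (fun v => 'i * circ r v / (circ r v - z)) = 'i * twopi%:C.
Proof.
move=> /andP[r0 r1] zr.
have hol1 : holomorphic_on (@udisc R) (fun=> 1) by move=> w _; exact: derivable_cst.
have qP : 0 <= cabs z / r < 1.
  by rewrite divr_ge0 ?cabs_ge0 ?(ltW r0) //= ltr_pdivrMr // mul1r.
apply/eqP; rewrite -subr_eq0 -cabs_eq0 eq_le cabs_ge0 andbT.
apply: (geometric_le0 (c := 2 * (cabs z / r / (r - cabs z)) * twopi) qP) => n.
have M1 v : 0 <= v <= twopi -> cabs (1 : R[i]) <= 1 by rewrite cabs1.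
(* [n.+1] terms, so that the term [k = 0] is always present; the additional factor [cabs z / r] was
   put into [c]. *)
have := cauchy_expansion r0 r1 hol1 n.+1 zr M1.
rewrite mul1r big_ord_recl /= expr0 mul1r.
rewrite big1 ?addr0 => [|k _]; last first.
  rewrite (_ : ci _ _ _ = 0) ?mulr0 //.
  rewrite -[0 in RHS]/((if k.+1 == 0%N then twopi else 0)%:C).
  by rewrite -(ci_circV k.+1 r0); apply: eq_ci => v _; rewrite mul1r.
rewrite (_ : ci _ _ (fun v => 1 * _) = twopi%:C); last first.
  by rewrite -(ci_circV 0 r0); apply: eq_ci => v _; rewrite mul1r.
move/le_trans; apply; rewrite exprS mul1r le_eqVlt; apply/orP; left; apply/eqP.
by ring.
Qed.

(** The coefficients may still depend on [r]; [taylor] removes this. The bound depends on [z]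
    through its modulus only, hence is uniform on circles. *)
Lemma taylor_radius r h : 0 < r < 1 -> holomorphic_on (@udisc R) h ->
  exists (c : nat -> R[i]) (M : R), forall z n, cabs z < r ->
    cabs (h z - \sum_(k < n) c k * z ^+ k) <= M / (r - cabs z) * (cabs z / r) ^+ n.
Proof.
move=> r01 hol; have /andP[r0 r1] := r01.
have [M hM] := bound_hcirc r0 r1 hol.
exists (fun k => twopi%:C^-1 * ci 0 twopi (fun v => h (circ r v) * (circ r v ^+ k)^-1)).
exists (2 * M) => z n zr.
have := cauchy_expansion r0 r1 hol n zr hM; rewrite winding_number //.
have p0 : twopi%:C != 0 :> R[i].
  by rewrite -cabs_eq0 cabs_realC normr_eq0 gt_eqF ?twopi_gt0.
set S := \sum_(k < n) z ^+ k * _.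
have -> : h z * ('i * twopi%:C) - 'i * S = 'i * twopi%:C * (h z - twopi%:C^-1 * S).
  by move: (twopi%:C) p0 => p p0; field.
rewrite !cabsM cabsi mul1r cabs_realC (gtr0_norm twopi_gt0) [leRHS]mulrC.
rewrite ler_pM2l ?twopi_gt0 // => /le_trans H.
have -> : \sum_(k < n) twopi%:C^-1 *
     ci 0 twopi (fun v => h (circ r v) * (circ r v ^+ k)^-1) *
   z ^+ k = twopi%:C^-1 * S.
  by rewrite mulr_sumr; apply: eq_bigr => k _; rewrite mulrAC mulrA.
by apply: H; rewrite le_eqVlt; apply/orP; left; apply/eqP; ring.
Qed.

End Taylor.

(** * Taylor coefficients as Fourier integrals *)

Section Coefficients.
Local Open Scope complex_scope.
Context {R : realType}.
Local Notation C := (Num.NumField.sort (R[i] : numFieldType)).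
Local Notation twopi := (2 * pi : R).
Local Notation holo := (holomorphic_on (@udisc R)).
Implicit Types (h g : R[i] -> R[i]) (z w : R[i]) (r : R) (b : nat -> R[i]) (n k : nat).

Definition geo_cvg (S : nat -> R[i]) (x : R[i]) :=
  exists (K q : R), 0 <= q < 1 /\ forall n, cabs (x - S n) <= K * q ^+ n.

Lemma geo_cvg_unique S x y : geo_cvg S x -> geo_cvg S y -> x = y.
Proof.
move=> [K [q [/andP[q0 q1] xS]]] [L [p [/andP[p0 p1] yS]]].
have K0 : 0 <= K by have := xS 0%N; rewrite expr0 mulr1; apply: le_trans (cabs_ge0 _).
have L0 : 0 <= L by have := yS 0%N; rewrite expr0 mulr1; apply: le_trans (cabs_ge0 _).
apply/eqP; rewrite -subr_eq0 -cabs_eq0 eq_le cabs_ge0 andbT.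
apply: (geometric_le0 (q := Num.max q p) (c := K + L)).
  by rewrite le_max q0 /= gt_max q1.
move=> n; rewrite (_ : x - y = (x - S n) + (S n - y)); last by ring.
apply: le_trans (cabsD _ _) _; rewrite mulrDl; apply: lerD.
  apply: le_trans (xS n) _; rewrite ler_wpM2l // lerXn2r ?nnegrE ?le_max ?q0 //.
  by rewrite lexx.
rewrite cabsB; apply: le_trans (yS n) _.
by rewrite ler_wpM2l // lerXn2r ?nnegrE ?le_max ?p0 ?lexx ?orbT.
Qed.

Lemma cabs_disc z t : cabs (z * expit t) = cabs z.
Proof. by rewrite cabsM cabs_expit mulr1. Qed.

Lemma cont_disc h z x y : holo h -> cabs z < 1 ->
  cont_on x y (fun t => h (z * expit t) : C).
Proof.
move=> hol z1 t _; apply: derivable_cont.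
  by apply: hol; apply/udiscP; rewrite cabs_disc.
by apply: cvgM; [exact: cvg_cst|exact: cont_expit].
Qed.

Lemma cont_expitV k x y : cont_on x y (fun t => (expit (k%:R * t))^-1 : C).
Proof. by apply: cont_onV; [move=> t _; exact: expit_neq0|exact: cont_expitM]. Qed.

(** The unnormalised convolution with [e^{-ikt}]: for [h] holomorphic in the disc it is [2 * pi]
    times the [k]-th Taylor term at [z] ([fourier_intE]). *)
Definition fourier_int h z k : R[i] :=
  ci 0 twopi (fun t => h (z * expit t) * (expit (k%:R * t))^-1).

(* Read off on |z| = 1/2; any radius below 1 gives the same value. *)
Definition taylor_coef k h : R[i] := (twopi%:C)^-1 * 2 ^+ k * fourier_int h 2^-1 k.

Lemma twopiC_neq0 : twopi%:C != 0 :> R[i].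
Proof. by rewrite -cabs_eq0 cabs_realC normr_eq0 gt_eqF ?twopi_gt0. Qed.

Lemma cabs_half : cabs (2^-1 : R[i]) = 2^-1.
Proof.
by rewrite cabsV cabs_nat.
Qed.

Lemma cabs_half_lt1 : cabs (2^-1 : R[i]) < 1.
Proof. by rewrite cabs_half; lra. Qed.

Lemma cont_polyE b n z x y :
  cont_on x y (fun t => \sum_(j < n) b j * (z * expit t) ^+ j : C).
Proof.
apply: (ci_sum n (F := fun j t => b j * (z * expit t) ^+ j : C) _).1 => j.
apply: cont_onM; first exact: cont_on_cst.
apply: cont_onX; apply: cont_onM; first exact: cont_on_cst.
by move=> t _; exact: cont_expit.
Qed.

Lemma fourier_int_poly b n z k :
  fourier_int (fun w => \sum_(j < n) b j * w ^+ j) z k =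
  (if (k < n)%N then twopi%:C * (b k * z ^+ k) else 0).
Proof.
pose F j t : C := b j * z ^+ j * (expit (j%:R * t) / expit (k%:R * t)).
have cE j : cont_on 0 twopi (fun t => expit (j%:R * t) / expit (k%:R * t) : C).
  by apply: cont_onM; [exact: cont_expitM|exact: cont_expitV].
have cF j : cont_on 0 twopi (F j) by apply: cont_onM; [exact: cont_on_cst|exact: cE].
transitivity (ci 0 twopi (fun t => \sum_(j < n) F j t)).
  apply: eq_ci => t _; rewrite mulr_suml; apply: eq_bigr => j _.
  by rewrite /F exprMn expitMn !mulrA.
rewrite (ci_sum n cF).2.
have FE j : ci 0 twopi (F j) = b j * z ^+ j * (if j == k then twopi else 0)%:C.
  by rewrite /F ciZ ?ci_expit_orth //; exact: cE.
case: ltnP => kn; last first.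
  apply: big1 => j _; rewrite FE ltn_eqF ?mulr0 //.
  exact: leq_trans (ltn_ord j) kn.
rewrite (bigD1 (Ordinal kn)) //= big1 ?addr0; last first.
  by move=> j jk; rewrite FE -val_eqE /= in jk *; rewrite (negbTE jk) mulr0.
by rewrite FE eqxx mulrC.
Qed.

Lemma fourier_int_lin (a : R[i]) h g z k :
  cont_on 0 twopi (fun t => h (z * expit t) : C) ->
  cont_on 0 twopi (fun t => g (z * expit t) : C) ->
  fourier_int (fun w => a * h w + g w) z k = a * fourier_int h z k + fourier_int g z k.
Proof.
move=> ch cg; rewrite /fourier_int.
have ch' := cont_onM ch (@cont_expitV k 0 twopi).
have cg' := cont_onM cg (@cont_expitV k 0 twopi).
rewrite -ciZ; last exact: ch'.
rewrite -ciD; [|by apply: cont_onM ch'; exact: cont_on_cst|exact: cg'].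
by apply: eq_ci => t _; rewrite mulrDl mulrA.
Qed.

(** A partial sum of length [n + k.+1] already contains the term of index [k], so it contributes the
    exact value; the rest is a uniform error on the circle, geometric in [n]. *)
Lemma fourier_int_cvg h b z k : holo h -> cabs z < 1 ->
  (exists K q : R, 0 <= q < 1 /\ forall w n, cabs w = cabs z ->
     cabs (h w - \sum_(j < n) b j * w ^+ j) <= K * q ^+ n) ->
  fourier_int h z k = twopi%:C * (b k * z ^+ k).
Proof.
move=> hol z1 [K [q [q01 H]]].
apply/eqP; rewrite -subr_eq0 -cabs_eq0 eq_le cabs_ge0 andbT.
apply: (geometric_le0 (q := q) (c := 2 * (K * q ^+ k.+1) * twopi)) => // n.
have ch := cont_disc (x := 0) (y := twopi) hol z1.
(* The signs are put into the coefficients so that [h] minus the partial sum has the form required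
   by [fourier_int_lin]. *)
pose p w := \sum_(j < n + k.+1) (- b j) * w ^+ j.
have cp : cont_on 0 twopi (fun t => p (z * expit t) : C).
  exact: (cont_polyE (b := fun j => - b j)).
have -> : fourier_int h z k - twopi%:C * (b k * z ^+ k) =
    fourier_int (fun w => 1 * h w + p w) z k.
  rewrite fourier_int_lin; [|exact: ch|exact: cp].
  rewrite mul1r (fourier_int_poly (fun j => - b j)) addnS ltnS leq_addl.
  by rewrite mulNr mulrN.
have -> : 2 * (K * q ^+ k.+1) * twopi * q ^+ n =
    2 * (K * q ^+ (n + k.+1)) * (twopi - 0).
  by rewrite exprD subr0; ring.
apply: ci_bound; first exact: ltW twopi_gt0.
  apply: cont_onM; last exact: cont_expitV.
  apply: cont_onD; last exact: cp.
  by apply: cont_onM; [exact: cont_on_cst|exact: ch].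
move=> t _; rewrite cabsM cabsV cabs_expit invr1 mulr1.
have := H (z * expit t) (n + k.+1)%N (cabs_disc _ _).
congr (cabs _ <= _); rewrite mul1r /p; congr (_ + _).
by rewrite -sumrN; apply: eq_bigr => j _; rewrite mulNr.
Qed.

Lemma taylor h z : holo h -> cabs z < 1 ->
  exists K q : R, 0 <= q < 1 /\ forall w n, cabs w = cabs z ->
    cabs (h w - \sum_(k < n) taylor_coef k h * w ^+ k) <= K * q ^+ n.
Proof.
(* [r] exceeds [cabs z], so the expansion is valid there, and also [1/2], the radius where
   [taylor_coef] is read off; the latter identifies the coefficients found at radius [r]. *)
move=> hol z1; pose r := (1 + Num.max (cabs z) 2^-1) / 2.
have zm : cabs z <= Num.max (cabs z) 2^-1 by rewrite le_max lexx.
have hm : 2^-1 <= Num.max (cabs z) 2^-1 by rewrite le_max lexx orbT.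
have m1 : Num.max (cabs z) 2^-1 < 1 by rewrite gt_max z1 /=; lra.
have r01 : 0 < r < 1 by rewrite /r; lra.
have zr : cabs z < r by rewrite /r; lra.
have hr : (2^-1 : R) < r by rewrite /r; lra.
have /andP[r0 r1] := r01.
have [c [M cM]] := taylor_radius r01 hol.
have unif x : 0 <= x < r -> exists K q : R, 0 <= q < 1 /\ forall w n, cabs w = x ->
    cabs (h w - \sum_(k < n) c k * w ^+ k) <= K * q ^+ n.
  move=> /andP[x0 xr]; exists (M / (r - x)), (x / r); split.
    by rewrite divr_ge0 ?(ltW r0) //= ltr_pdivrMr // mul1r.
  by move=> w n wx; rewrite -wx; apply: cM; rewrite wx.
have cE k : c k = taylor_coef k h.
  rewrite /taylor_coef (@fourier_int_cvg h c) ?cabs_half_lt1 //; last first.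
    by rewrite cabs_half; apply: unif; rewrite invr_ge0 ler0n hr.
  have p0 := twopiC_neq0; rewrite exprVn mulrCA -!mulrA mulVKf //.
  by rewrite mulrCA mulfV ?mulr1 // expf_neq0 // pnatr_eq0.
have [|K [q [q01 Kq]]] := unif (cabs z); first by rewrite cabs_ge0 zr.
exists K, q; split => // w n wz.
by have := Kq w n wz; under eq_bigr do rewrite cE.
Qed.

Lemma taylor_cvg h z : holo h -> cabs z < 1 ->
  geo_cvg (fun n => \sum_(k < n) taylor_coef k h * z ^+ k) (h z).
Proof.
by move=> hol /(taylor hol)[K [q [q01 H]]]; exists K, q; split => // n; exact: H.
Qed.

Lemma fourier_intE h z k : holo h -> cabs z < 1 ->
  fourier_int h z k = twopi%:C * (taylor_coef k h * z ^+ k).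
Proof.
move=> hol z1.
exact: (fourier_int_cvg (b := fun j => taylor_coef j h) _ hol z1 (taylor hol z1)).
Qed.

Lemma taylor_coef_lin (a : R[i]) h g k : holo h -> holo g ->
  taylor_coef k (fun w => a * h w + g w) = a * taylor_coef k h + taylor_coef k g.
Proof.
move=> hh hg; rewrite /taylor_coef fourier_int_lin; last 2 first.
- exact: (cont_disc hh cabs_half_lt1).
- exact: (cont_disc hg cabs_half_lt1).
by ring.
Qed.

Lemma eq_fourier_int h g z k : (forall w, cabs w = cabs z -> h w = g w) ->
  fourier_int h z k = fourier_int g z k.
Proof. by move=> E; apply: eq_ci => t _; rewrite E // cabs_disc. Qed.

Lemma eq_taylor_coef h g k : (forall z, udisc z -> h z = g z) ->
  taylor_coef k h = taylor_coef k g.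
Proof.
move=> E; rewrite /taylor_coef; congr (_ * _); apply: eq_fourier_int => w w2.
by apply: E; apply/udiscP; rewrite w2 cabs_half_lt1.
Qed.

Lemma taylor_coef_poly b n k : taylor_coef k (fun w => \sum_(j < n) b j * w ^+ j) =
  if (k < n)%N then b k else 0.
Proof.
rewrite /taylor_coef fourier_int_poly; case: ifP => _; last by rewrite mulr0.
have p0 := twopiC_neq0; rewrite exprVn mulrCA -!mulrA mulVKf //.
by rewrite mulrCA mulfV ?mulr1 // expf_neq0 // pnatr_eq0.
Qed.

Lemma taylor_coef_inj h g : holo h -> holo g ->
  (forall k, taylor_coef k h = taylor_coef k g) ->
  forall z, udisc z -> h z = g z.
Proof.
move=> hh hg E z /udiscP z1; apply: geo_cvg_unique (taylor_cvg hh z1) _.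
have := taylor_cvg hg z1.
by under [X in geo_cvg X]funext => n do under eq_bigr => k _ do rewrite -E.
Qed.

End Coefficients.

(** * Dilations and monomials *)

Section Entire.
Local Open Scope complex_scope.
Context {R : realType}.

Lemma derivable_scale (h : R[i] -> R[i]) (c z : R[i]) :
  derivable (h : R[i]^o -> R[i]^o) (c * z) 1 ->
  derivable ((fun w => h (c * w)) : R[i]^o -> R[i]^o) z 1.
Proof.
move=> /derivable1_diffP dh; apply/derivable1_diffP.
have dc : differentiable ((fun w => c * w) : R[i]^o -> R[i]^o) (z : R[i]^o).
  by apply/derivable1_diffP/derivableZ/derivable_id.
exact: (differentiable_comp dc dh).
Qed.

Lemma entire_monomial k : entire (fun z : R[i] => z ^+ k).
Proof.
move=> z _; have -> : (fun w : R[i] => w ^+ k) = (id ^+ k : R[i]^o -> R[i]^o).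
  apply/funext => w; elim: k => [|k IH]; first by rewrite !expr0.
  by rewrite !exprS /= IH.
by apply: derivableX; exact: derivable_id.
Qed.

End Entire.

(** * Geometrically convergent series in the Banach space *)

Section Space.
Local Open Scope complex_scope.
Context {R : realType} (V : completeNormedModType R[i]).
Implicit Types (u v w : V).

(** The norm of [V] is [R[i]]-valued; this real form is convertible to the one in [E_n] and
    [admissible_space]. *)
Definition vnorm u : R := cabs `|u|.

Lemma vnormE u : `|u| = (vnorm u)%:C.
Proof. exact: cabs_nneg. Qed.

Lemma vnorm_ge0 u : 0 <= vnorm u.
Proof. exact: cabs_ge0. Qed.

Lemma vnorm_eq0 u : (vnorm u == 0) = (u == 0).
Proof. by rewrite -(normr_eq0 u) -cabs_eq0. Qed.

Lemma vnormD u v : vnorm (u + v) <= vnorm u + vnorm v.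
Proof. by rewrite -lecR rmorphD /= -!vnormE ler_normD. Qed.

Lemma vnormZ (a : R[i]) u : vnorm (a *: u) = cabs a * vnorm u.
Proof. by apply: complexI; rewrite -vnormE normrZ rmorphM /= -vnormE -normCE. Qed.

Lemma vnormB u v : vnorm (u - v) = vnorm (v - u).
Proof. by rewrite /vnorm distrC. Qed.

Lemma vnorm_sum n (x : nat -> V) : vnorm (\sum_(k < n) x k) <= \sum_(k < n) vnorm (x k).
Proof.
elim: n => [|n IH]; first by rewrite !big_ord0 /vnorm normr0 cabs0.
by rewrite !big_ord_recr /=; apply: le_trans (vnormD _ _) _; rewrite lerD2r.
Qed.

Lemma geometric_sum_le (q : R) m : 0 <= q < 1 -> \sum_(k < m) q ^+ k <= (1 - q)^-1.
Proof.
move=> /andP[q0 q1]; have q'0 : 0 < 1 - q by rewrite subr_gt0.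
rewrite -(ler_pM2l q'0) mulfV ?gt_eqF //.
suff -> : (1 - q) * \sum_(k < m) q ^+ k = 1 - q ^+ m.
  by rewrite lerBlDr lerDl exprn_ge0.
elim: m => [|m IH]; first by rewrite big_ord0 mulr0 expr0 subrr.
by rewrite big_ord_recr /= mulrDr IH exprS; ring.
Qed.

Lemma geometric_tail (x : nat -> V) (K q : R) n m : 0 <= q < 1 ->
  (forall k, vnorm (x k) <= K * q ^+ k) ->
  vnorm (\sum_(k < n + m) x k - \sum_(k < n) x k) <= K / (1 - q) * q ^+ n.
Proof.
move=> q01 H; have /andP[q0 q1] := q01.
have K0 : 0 <= K by have := H 0%N; rewrite expr0 mulr1; apply: le_trans (vnorm_ge0 _).
rewrite big_split_ord /= (addrC (\sum_(i < n) _)) addrK.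
apply: le_trans (vnorm_sum m (fun k => x (n + k)%N)) _.
have : \sum_(k < m) vnorm (x (n + k)%N) <= \sum_(k < m) K * q ^+ n * q ^+ k.
  by apply: ler_sum => k _; rewrite -mulrA -exprD.
move/le_trans; apply; rewrite -mulr_sumr [leRHS]mulrAC; apply: ler_wpM2l.
  by rewrite mulr_ge0 // exprn_ge0.
exact: geometric_sum_le.
Qed.

Lemma geometric_small (K q e : R) : 0 <= q < 1 -> 0 < e -> exists n, K * q ^+ n < e.
Proof.
move=> q01 e0; apply: contrapT => /forallNP H.
have : e <= 0.
  by apply: (geometric_le0 (c := K) q01) => n; rewrite leNgt; apply/negP; exact: H.
by rewrite leNgt e0.
Qed.

(** Completeness enters here. The rate is kept in the conclusion because it becomes the bound on
    [E_n]. *)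
Lemma geometric_series (x : nat -> V) (K q : R) : 0 <= q < 1 ->
  (forall k, vnorm (x k) <= K * q ^+ k) ->
  exists w, forall n, vnorm (w - \sum_(k < n) x k) <= K / (1 - q) * q ^+ n.
Proof.
move=> q01 H; pose S n := \sum_(k < n) x k.
have tail n m : (n <= m)%N -> vnorm (S m - S n) <= K / (1 - q) * q ^+ n.
  by move=> nm; rewrite -(subnKC nm); exact: geometric_tail.
have : cauchy (S n @[n --> \oo]).
  apply: cauchy_exP => _ /pos_complexP[e e0 ->].
  have [n ne] := geometric_small (K / (1 - q)) q01 e0.
  exists (S n); exists n => // m /= nm.
  rewrite -ball_normE /ball_ /= vnormE ltcR vnormB.
  exact: le_lt_trans (tail _ _ nm) ne.
move=> /cauchy_cvg /cvg_ex[w /cvgrPdist_lt wS]; exists w => n.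
apply/ler_addgt0Pr => e e0.
have e0C : 0 < e%:C :> R[i] by rewrite ltcR.
have [N _ NS] := wS _ e0C.
have nN : (n <= maxn n N)%N by rewrite leq_maxl.
have := NS (maxn n N); rewrite /= leq_maxr vnormE ltcR => /(_ isT) wN.
have -> : w - \sum_(k < n) x k = (S (maxn n N) - S n) + (w - S (maxn n N)).
  by rewrite [RHS]addrC addrA subrK.
apply: le_trans (vnormD _ _) _; apply: lerD; first exact: tail.
exact: ltW.
Qed.

End Space.

(** * Coefficient functionals and power series in an admissible space *)

Section Admissible.
Local Open Scope complex_scope.
Context {R : realType} (V : completeNormedModType R[i]) (j : V -> R[i] -> R[i]).
Hypothesis hX : admissible_space j.
Implicit Types (u v w : V) (z : R[i]) (b : nat -> R[i]).
Local Notation C := (Num.NumField.sort (R[i] : numFieldType)).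

Lemma j_lin (a : R[i]) u v z : udisc z -> j (a *: u + v) z = a * j u z + j v z.
Proof. by case: hX => H _; exact: H. Qed.

Lemma j_inj u v : (forall z, udisc z -> j u z = j v z) -> u = v.
Proof. by case: hX => _ [H _]; exact: H. Qed.

Lemma j_holo u : holomorphic_on (@udisc R) (j u).
Proof. by case: hX => _ [_ [H _]]; exact: H. Qed.

Lemma j_entire F : entire F -> exists w, forall z, udisc z -> j w z = F z.
Proof. by case: hX => _ [_ [_ [_ [H _]]]]; exact: H. Qed.

Lemma j0 z : udisc z -> j 0 z = 0.
Proof.
move=> z1; have := j_lin 1 0 0 z1; rewrite scaler0 addr0 mul1r => /eqP.
by rewrite -subr_eq0 opprD addrA subrr sub0r oppr_eq0 => /eqP.
Qed.

Lemma jZ (a : R[i]) u z : udisc z -> j (a *: u) z = a * j u z.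
Proof. by move=> z1; have := j_lin a u 0 z1; rewrite addr0 j0 // addr0. Qed.

Lemma j_sum n (x : nat -> V) z : udisc z ->
  j (\sum_(k < n) x k) z = \sum_(k < n) j (x k) z.
Proof.
move=> z1; elim: n => [|n IH]; first by rewrite !big_ord0 j0.
by rewrite !big_ord_recr /= -IH addrC -[x n]scale1r j_lin // jZ // addrC.
Qed.

Lemma udisc_half : udisc (2^-1 : R[i]).
Proof. by apply/udiscP; exact: cabs_half_lt1. Qed.

Lemma taylor_coefj_lin (a : R[i]) u v k :
  taylor_coef k (j (a *: u + v)) = a * taylor_coef k (j u) + taylor_coef k (j v).
Proof.
rewrite -taylor_coef_lin; try exact: j_holo.
by apply: eq_taylor_coef => z z1; rewrite j_lin.
Qed.

Lemma taylor_coefjB u v k :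
  taylor_coef k (j (u - v)) = taylor_coef k (j u) - taylor_coef k (j v).
Proof. by rewrite addrC -scaleN1r taylor_coefj_lin mulN1r addrC. Qed.

Lemma taylor_coefj_inj u v : (forall k, taylor_coef k (j u) = taylor_coef k (j v)) -> u = v.
Proof. by move=> H; apply: j_inj; apply: taylor_coef_inj => //; exact: j_holo. Qed.

(** [j_entire] gives mere existence, hence the choice; [j_inj] makes the element unique. *)
Definition monomial k : V := projT1 (cid (j_entire (@entire_monomial R k))).

Lemma monomialE k z : udisc z -> j (monomial k) z = z ^+ k.
Proof. exact: (projT2 (cid (j_entire (@entire_monomial R k)))). Qed.

Lemma vnorm_monomial_gt0 k : 0 < vnorm (monomial k).
Proof.
rewrite lt_neqAle eq_sym vnorm_ge0 vnorm_eq0 andbT; apply/negP => /eqP m0.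
have := monomialE k udisc_half; rewrite m0 j0 ?udisc_half //; last exact: udisc_half.
by move/eqP; rewrite eq_sym expf_eq0 invr_eq0 pnatr_eq0 andbF.
Qed.

Lemma taylor_coef_bound u k : cabs (taylor_coef k (j u)) * vnorm (monomial k) <= vnorm u.
Proof.
pose g t : R[i] := (expit (k%:R * t))^-1.
have cg : cL1 g.
  by apply: (@cont_on_integrable R 0 (2 * pi) g); exact: cont_expitV.
have [w [wE wu]] : exists w : V, (forall z, udisc z -> j w z =
   ((2 * pi)^-1)%:C * cint (fun t => j u (z * expit t) * g t)) /\
   vnorm w <= (2 * pi)^-1 * Rintegral lebesgue_measure (@I02pi R) (fun t => cabs (g t))
     * vnorm u.
  by case: hX => _ [_ [_ [_ [_ H]]]]; exact: H.
(* By injectivity of [j] the convolution is [taylor_coef k (j u) *: monomial k]; the mean of the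
   modulus of [g] is 1, so no constant is lost. *)
have -> : cabs (taylor_coef k (j u)) * vnorm (monomial k) = vnorm w.
  rewrite -vnormZ; congr vnorm; apply: j_inj => z z1.
  rewrite jZ // monomialE // wE //.
  rewrite -[cint _]/(fourier_int (j u) z k) fourier_intE; [|exact: j_holo|exact/udiscP].
  by rewrite fmorphV mulKf // twopiC_neq0.
apply: le_trans wu _.
have -> : (fun t => cabs (g t)) = cst 1.
  by apply/funext => t; rewrite /g cabsV cabs_expit invr1.
rewrite Rintegral_cst; last exact: measurable_itv.
have -> : fine (lebesgue_measure (@I02pi R)) = 2 * pi.
  by rewrite -[RHS]subr0; exact: (itv_measure (ltW twopi_gt0)).
by rewrite mul1r mulVf ?mul1r // gt_eqF ?twopi_gt0.
Qed.

Lemma polys_n_sum b n : polys_n j n (\sum_(k < n) b k *: monomial k).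
Proof.
exists (\poly_(k < n) b k); split; first exact: size_poly.
move=> z z1; rewrite horner_poly (j_sum n (fun k => b k *: monomial k)) //.
by apply: eq_bigr => k _; rewrite jZ // monomialE.
Qed.

Lemma taylor_coef_polys_n n k p : polys_n j n p -> (n <= k)%N -> taylor_coef k (j p) = 0.
Proof.
move=> [q [qn qE]] nk.
rewrite (eq_taylor_coef (g := fun z => \sum_(i < size q) q`_i * z ^+ i)); last first.
  by move=> z z1; rewrite qE // horner_coef.
by rewrite taylor_coef_poly ltnNge (leq_trans qn nk).
Qed.

(** Used in both directions: its approximants bound [E_n], and its existence part produces the
    dilates of [f]. *)
Lemma series_of_taylor_coef b (K q : R) : 0 <= q < 1 ->
  (forall k, cabs (b k) * vnorm (monomial k) <= K * q ^+ k) ->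
  exists w, (forall k, taylor_coef k (j w) = b k) /\
  forall n, exists2 p, polys_n j n p & vnorm (w - p) <= K / (1 - q) * q ^+ n.
Proof.
move=> q01 H; pose x k := b k *: monomial k.
have xH k : vnorm (x k) <= K * q ^+ k by rewrite vnormZ.
have [w wH] := geometric_series q01 xH.
exists w; split; last by move=> n; exists (\sum_(k < n) x k) => //; exact: polys_n_sum.
move=> k; apply/eqP; rewrite -subr_eq0 -cabs_eq0 eq_le cabs_ge0 andbT.
rewrite -(pmulr_lle0 _ (vnorm_monomial_gt0 k)).
(* Partial sums of length [k + n.+1] have [k]-th coefficient exactly [b k], so [taylor_coef_bound]
   applied to the tail controls the discrepancy. *)
apply: (geometric_le0 (c := K / (1 - q) * q ^+ k.+1) q01) => n.
rewrite -mulrA -exprD addSnnS; apply: le_trans (wH _).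
rewrite mulrC; apply: le_trans (taylor_coef_bound _ k); rewrite taylor_coefjB.
have -> : taylor_coef k (j (\sum_(i < k + n.+1) x i)) = b k; last by rewrite mulrC.
rewrite (eq_taylor_coef (g := fun z => \sum_(i < k + n.+1) b i * z ^+ i)).
  by rewrite taylor_coef_poly addnS ltnS leq_addr.
by move=> z z1; rewrite j_sum //; apply: eq_bigr => i _; rewrite jZ // monomialE.
Qed.

End Admissible.

(** * Best approximation and the two implications *)

Section BestApproximation.
Local Open Scope complex_scope.
Context {R : realType} (V : completeNormedModType R[i]) (j : V -> R[i] -> R[i]).
Hypothesis hX : admissible_space j.
Implicit Types (u v w f : V) (z : R[i]).
Local Notation monomial := (monomial hX).

Lemma E_n_le n f p : polys_n j n p -> E_n j n f <= vnorm (f - p).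
Proof.
move=> pn; apply: ge_inf; last by exists p.
by exists 0 => _ [q _ <-]; exact: cabs_ge0.
Qed.

Lemma le_E_n n f (x : R) : (forall p, polys_n j n p -> x <= vnorm (f - p)) ->
  x <= E_n j n f.
Proof.
move=> H; apply: lb_le_inf; last by move=> _ [p pn <-]; exact: H.
(* The set of distances is nonempty: the zero combination belongs to [polys_n j n]. *)
exists (cabs `|f - \sum_(k < n) (0 : R[i]) *: monomial k|).
by eexists; first exact: (polys_n_sum hX (fun=> 0)).
Qed.

Lemma E_n_ge0 n f : 0 <= E_n j n f.
Proof. by apply: le_E_n => p _; exact: vnorm_ge0. Qed.

(** Polynomials of degree at most [n - 1] have no [n]-th coefficient, so [f - p] has that of [f] for
    every competitor [p]. *)
Lemma taylor_coef_le_E_n n f : cabs (taylor_coef n (j f)) * vnorm (monomial n) <= E_n j n f.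
Proof.
apply: le_E_n => p pn; apply: le_trans (taylor_coef_bound hX _ n).
by rewrite taylor_coefjB // (taylor_coef_polys_n pn) // subr0.
Qed.

Lemma geometric_E_n_of_entire f F (rho : R) : 1 < rho ->
  entire F -> (forall z, udisc z -> j f z = F z) ->
  exists K, forall n, E_n j n f <= K * rho^-1 ^+ n.
Proof.
move=> rho1 Fe fF; have rho0 : 0 < rho := lt_trans ltr01 rho1.
have rC0 : rho%:C != 0 :> R[i] by rewrite -cabs_eq0 cabs_realC normr_eq0 gt_eqF.
have Ge : entire (fun z => F (rho%:C * z)).
  by move=> z _; apply: derivable_scale; exact: Fe.
have [w wG] := j_entire hX Ge.
have q01 : 0 <= rho^-1 < 1 by rewrite invr_ge0 ltW //= invf_lt1.
have coefE k : taylor_coef k (j f) = rho^-1%:C ^+ k * taylor_coef k (j w).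
  (* Dilation by [rho] carries the circle through [z] onto the circle of radius [1/2], so the two
     Fourier integrals have the same integrand. *)
  pose z : R[i] := rho^-1%:C * 2^-1.
  have zE : cabs z = rho^-1 * 2^-1.
    by rewrite cabsM cabs_realC cabs_half ger0_norm // invr_ge0 ltW.
  have z1 : cabs z < 1.
    rewrite zE -[ltRHS]mulr1; apply: ltr_pM; rewrite ?invr_ge0 ?(ltW rho0) //.
      by case/andP: q01.
    by lra.
  have : fourier_int (j w) z k = fourier_int (j f) 2^-1 k.
    apply: eq_ci => t _; rewrite wG; last by apply/udiscP; rewrite cabs_disc.
    rewrite fF; last by apply/udiscP; rewrite cabs_disc cabs_half_lt1.
    by rewrite /z !mulrA fmorphV mulfV // mul1r.
  rewrite !fourier_intE ?cabs_half_lt1 //; try exact: j_holo.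
  move/(mulfI (twopiC_neq0)); rewrite /z exprMn mulrA.
  have h0 : (2^-1 : R[i]) ^+ k != 0 by rewrite expf_neq0 // invr_neq0 // pnatr_eq0.
  by move/(mulIf h0) => <-; rewrite mulrC.
have [||w' [w'E w'P]] := series_of_taylor_coef (hX := hX)
  (b := fun k => taylor_coef k (j f))
  (K := vnorm w) (q := rho^-1); first exact: q01.
  move=> k; rewrite coefE cabsM cabsX cabs_realC ger0_norm ?invr_ge0 ?(ltW rho0) //.
  rewrite -mulrA mulrC ler_wpM2r ?exprn_ge0 ?invr_ge0 ?(ltW rho0) //.
  exact: taylor_coef_bound.
(* The Taylor series is first summed in [V] to [w']; equality of coefficients then identifies the
   sum with [f]. *)
have -> : f = w' by apply: (taylor_coefj_inj hX) => k; rewrite w'E.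
exists (vnorm w / (1 - rho^-1)) => n.
have [p pn] := w'P n; apply: le_trans; exact: E_n_le.
Qed.

(** [K] is not controlled, so the target is [(2 / rho) ^+ n] rather than [rho^-1 ^+ n]: the factor
    [2 ^+ n] eventually absorbs [K]. *)
Lemma root_cvg0_of_geometric (x : nat -> R) :
  (forall n, 0 <= x n) ->
  (forall rho, 1 < rho -> exists K, forall n, x n <= K * rho^-1 ^+ n) ->
  (fun n : nat => x n.+1 `^ (n.+1%:R)^-1) @ \oo --> (0 : R).
Proof.
move=> x0 H; apply/cvgrPdist_le => e e0.
pose rho := Num.max 2 (2 / e).
have rho2 : 2 <= rho by rewrite le_max lexx.
have rho0 : 0 < rho by lra.
have rhoe : 2 / rho <= e.
  have : 2 / e <= rho by rewrite le_max lexx orbT.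
  by rewrite !ler_pdivrMr // mulrC.
have rho1 : 1 < rho by lra.
have [K KP] := H rho rho1.
near=> n; rewrite sub0r normrN ger0_norm ?powR_ge0 //.
apply: le_trans rhoe.
have n0 : (n.+1%:R : R) != 0 by rewrite pnatr_eq0.
have y0 : 0 <= 2 / rho by rewrite divr_ge0 // ltW.
have -> : 2 / rho = ((2 / rho) ^+ n.+1) `^ (n.+1%:R)^-1.
  by rewrite -powR_mulrn // -powRrM mulfV // powRr1.
apply: ge0_ler_powR; rewrite ?nnegrE ?invr_ge0 ?exprn_ge0 //.
apply: le_trans (KP _) _.
rewrite expr_div_n exprVn ler_wpM2r ?invr_ge0 ?exprn_ge0 ?(ltW rho0) //.
have Kn : K <= n%:R by near: n; exact: nbhs_infty_ger.
apply: le_trans Kn _; rewrite -natrX ler_nat.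
by apply: leq_trans (leqnSn n) _; apply: ltnW; exact: ltn_expl.
Unshelve. all: by end_near. Qed.

(** In the constant, the 1 serves the indices from [N] on, and the sum dominates each of the
    finitely many earlier ratios. *)
Lemma eventually_geometric (x : nat -> R) (q : R) : 0 < q -> (forall n, 0 <= x n) ->
  (\forall n \near \oo, x n <= q ^+ n) -> exists K, forall n, x n <= K * q ^+ n.
Proof.
move=> q0 x0 [N _ NP]; exists (1 + \sum_(k < N) x k / q ^+ k) => n.
have s0 k : 0 <= x k / q ^+ k by rewrite divr_ge0 // exprn_ge0 // ltW.
have qn : 0 < q ^+ n by rewrite exprn_gt0.
rewrite -ler_pdivrMr //; have [Nn|nN] := leqP N n.
  apply: le_trans (_ : 1 <= _); first by rewrite ler_pdivrMr // mul1r; exact: NP.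
  by rewrite lerDl sumr_ge0.
rewrite (bigD1 (Ordinal nN)) //= addrCA lerDl addr_ge0 // sumr_ge0 //.
Qed.

Lemma geometric_of_root_cvg0 (x : nat -> R) (q : R) : 0 < q -> (forall n, 0 <= x n) ->
  (fun n : nat => x n.+1 `^ (n.+1%:R)^-1) @ \oo --> (0 : R) ->
  exists K, forall n, x n <= K * q ^+ n.
Proof.
move=> q0 x0 /cvgrPdist_le /(_ q q0) [N _ NP].
(* The root of index [n] controls [x n.+1], so the threshold moves to [N.+1], which also excludes
   index 0. *)
apply: eventually_geometric => //; exists N.+1 => // -[//|n] /= Nn.
have := NP n Nn; rewrite /= sub0r normrN ger0_norm ?powR_ge0 // => H.
have n0 : (n.+1%:R : R) != 0 by rewrite pnatr_eq0.
rewrite -(powRr1 (x0 n.+1)) -(mulVf n0) powRrM powR_mulrn ?powR_ge0 //.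
by rewrite lerXn2r ?nnegrE ?powR_ge0 // ltW.
Qed.

Lemma entire_of_geometric_E_n f :
  (forall q : R, 0 < q -> exists K, forall n, E_n j n f <= K * q ^+ n) ->
  exists F : R[i] -> R[i], entire F /\ forall z, udisc z -> j f z = F z.
Proof.
move=> H.
have step (N : nat) : exists w,
    forall k, taylor_coef k (j w) = taylor_coef k (j f) * N.+1%:R ^+ k.
  (* With this ratio, multiplying the [k]-th coefficient by [N.+1%:R ^+ k] still leaves decay of
     ratio [1/2]. *)
  have q0 : 0 < (N.+1%:R * 2)^-1 :> R by rewrite invr_gt0 mulr_gt0.
  have [K KP] := H _ q0.
  have q01 : 0 <= (2^-1 : R) < 1 by lra.
  have [|w [wE _]] := series_of_taylor_coef (hX := hX)
    (b := fun k => taylor_coef k (j f) * N.+1%:R ^+ k)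
    (K := K) q01; last by exists w.
  move=> k; rewrite cabsM cabsX.
  rewrite cabs_nat mulrAC -ler_pdivlMr ?exprn_gt0 //.
  apply: le_trans (taylor_coef_le_E_n k f) _; apply: le_trans (KP k) _.
  by rewrite -exprVn -mulrA -exprMn [_ * _^-1]mulrC -invfM.
have [W WE] := choice step.
(* The dilates take the value of the Taylor series of [f] at [z], whatever [N], so they agree where
   they overlap. *)
have Wcvg z N : cabs z < N.+1%:R ->
    geo_cvg (fun n => \sum_(k < n) taylor_coef k (j f) * z ^+ k)
      (j (W N) (N.+1%:R^-1 * z)).
  move=> zN; have NC : N.+1%:R != 0 :> R[i] by rewrite pnatr_eq0.
  have z1 : cabs (N.+1%:R^-1 * z) < 1.
    by rewrite cabsM cabsV cabs_nat mulrC ltr_pdivrMr // mul1r.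
  have := taylor_cvg (@j_holo _ _ _ hX (W N)) z1.
  congr geo_cvg; apply/funext => n; apply: eq_bigr => k _.
  by rewrite WE exprMn exprVn -mulrA mulVKf // expf_neq0.
pose F z := j (W (Num.trunc (cabs z))) ((Num.trunc (cabs z)).+1%:R^-1 * z).
have FE z N : cabs z < N.+1%:R -> F z = j (W N) (N.+1%:R^-1 * z).
  move=> zN; apply: geo_cvg_unique (Wcvg z N zN).
  by apply: Wcvg; exact: truncnS_gt.
exists F; split; last first.
  move=> z /udiscP z1; apply: geo_cvg_unique (taylor_cvg (@j_holo _ _ _ hX f) z1) _.
  exact: (Wcvg _ _ (truncnS_gt _)).
move=> z _; set N := Num.trunc (cabs z).
have zN : cabs z < N.+1%:R := truncnS_gt _.
pose G z := j (W N) (N.+1%:R^-1 * z).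
(* The index chosen by [F] may jump near [z]. With [N] frozen, [G] agrees with [F] on the ball of
   radius [N.+1%:R - cabs z], by [FE]. *)
apply: (@near_eq_derivable _ _ _ (G : R[i]^o -> R[i]^o)).
  have e0 : 0 < (N.+1%:R - cabs z)%:C :> R[i] by rewrite ltcR subr_gt0.
  apply/nbhs_ballP; exists (N.+1%:R - cabs z)%:C => //= y.
  rewrite -ball_normE /ball_ /= => zy; rewrite /G -FE //.
  have {}zy : cabs (z - y) < N.+1%:R - cabs z by rewrite -ltcR -normCE.
  rewrite -(subrK z y); apply: le_lt_trans (cabsD _ _) _.
  by rewrite cabsB -ltrBrDr.
apply: derivable_scale; apply: (j_holo hX); apply/udiscP.
by rewrite cabsM cabsV cabs_nat mulrC ltr_pdivrMr // mul1r.
Qed.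

End BestApproximation.

Theorem theorem2p1 (R : realType) (V : completeNormedModType R[i])
  (j : V -> R[i] -> R[i]) (hX : admissible_space j) (f : V) :
  (exists F : R[i] -> R[i], entire F /\ forall z, udisc z -> j f z = F z) <->
  ((fun n : nat => E_n j n.+1 f `^ (n.+1%:R)^-1) @ \oo --> (0 : R)).
Proof.
split=> [[F [Fe fF]]|H].
  apply: (root_cvg0_of_geometric (x := fun n => E_n j n f)) => [n|rho rho1].
    exact: E_n_ge0.
  exact: geometric_E_n_of_entire rho1 Fe fF.
apply: (entire_of_geometric_E_n hX) => q q0.
by apply: geometric_of_root_cvg0 => // n; exact: E_n_ge0.
Qed.
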